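(* Let $\beta(\alpha)$ (for $-1<\alpha\le 1/2$) and $\bar\alpha$ be as defined in the context. Then: (i) for $-1<\alpha\le\tfrac12$, $$\max\left(-\alpha-1,\ -\frac12\right)<\beta(\alpha)\le-\frac13(\alpha+1);$$ (ii) $\displaystyle\lim_{\alpha\to-1+}\beta(\alpha)=0$ and $\displaystyle\beta\left(\frac12\right)=-\frac12$; (iii) $\displaystyle-\frac12<\bar\alpha\le-\frac14$.
   Context: $J_\alpha$ denotes the Bessel function of the first kind of order $\alpha$, and for $\alpha>-1$, $j_{\alpha,2}$ denotes the second positive zero of $J_\alpha(t)$. For $-1<\alpha\le 1/2$, $\beta(\alpha)$ denotes the unique zero of the function $$A(\beta)=\int_0^{j_{\alpha,2}}t^{-\beta}J_\alpha(t)\,dt,\qquad -\frac12<\beta<\alpha+1.$$ It is a known result that, for $-1<\alpha\le 1/2$ (and $\beta<\alpha+1$), the inequality $\int_0^x t^{-\beta}J_\alpha(t)\,dt\ge 0$ holds for all $x>0$ if and only if $\beta\ge\beta(\alpha)$. The number $\bar\alpha$ denotes the unique zero of $$G(\alpha)=\int_0^{j_{\alpha,2}}t^{-\alpha}J_\alpha(t)\,dt,\qquad \alpha>-\frac12.$$ It is a known result that $\int_0^x t^{-\alpha}J_\alpha(t)\,dt\ge 0$ holds for all $x>0$ when $\alpha\ge\bar\alpha$; equivalently, $\bar\alpha$ is the unique solution of $\beta(\alpha)=\alpha$.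
   Formalization: At α=1/2 the strict bound in (i) reads -1/2<β(1/2)≤-1/2, contradicting (ii); the lower bound in (i) is strict only for α<1/2 and non-strict at α=1/2, and β(α) is defined as the unique zero on -1/2≤β<α+1 (endpoint included, since β(1/2)=-1/2). *)

(* Defs.v *)
From Stdlib Require Import Reals Factorial.
From Coquelicot Require Import Coquelicot.
Open Scope R_scope.

(** Euler's Gamma function, meaningful for [0 < x]. *)
Definition Gamma (x : R) : R :=
  RInt_gen (fun t => Rpower t (x - 1) * exp (- t))
    (at_right 0) (Rbar_locally p_infty).

(** [J_a(t)], meaningful for [-1 < a] (so that every Gamma argument is
    positive) and [0 < t] (as [Rpower] is the real power of a positive base). *)
Definition bessel_J (a t : R) : R :=
  Series (fun m : nat =>
    (-1) ^ m / (INR (fact m) * Gamma (INR m + a + 1))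
    * Rpower (t / 2) (2 * INR m + a)).

(** For [1 <= k], the [k]-th positive zero of [J_a]: the infimum of the zeros
    beyond the [(k-1)]-th one.  It is attained because the positive zeros are
    infinite in number and accumulate neither at [0] nor at any positive point.
    The value [0] at [k = 0] only starts the recursion. *)
Fixpoint bessel_zero (a : R) (k : nat) : R :=
  match k with
  | O => 0
  | S k' => real (Glb_Rbar (fun t => bessel_zero a k' < t /\ bessel_J a t = 0))
  end.

(** The integral is improper at [0]; it converges when [b < a + 1]. *)
Definition A (a b : R) : R :=
  RInt_gen (fun t => Rpower t (- b) * bessel_J a t)
    (at_right 0) (at_point (bessel_zero a 2)).

Definition G (a : R) : R := A a a.

(** [b] is the unique zero of [A a] on [-1/2 <= b < a + 1].  The endpoint
    [-1/2] is included because for [a = 1/2], where [J_a(t)] is a constant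
    multiple of [sin t / sqrt t], the zero of [A a] is exactly [-1/2].  For
    [-1 < a < 1/2] one has [A a (-1/2) < 0], so including it changes nothing. *)
Definition is_beta (a b : R) : Prop :=
  unique (fun b' => -1/2 <= b' < a + 1 /\ A a b' = 0) b.

Definition is_alpha_bar (a : R) : Prop :=
  unique (fun a' => -1/2 < a' /\ G a' = 0) a.

(* Main.v *)
Require Import Defs.
From Stdlib Require Import Reals Factorial Lra Lia Classical.
From Coquelicot Require Import Coquelicot.
Open Scope R_scope.

(** Write [c = a + 1] and [B(t) = sum_m (-1)^m (t^2/4)^m / ((c)_m m!)], so that
    [J_a(t)] is a positive constant times [t^a B(t)].  With [p = a + 1 - b],
    [A a b] is a positive constant times [I_p(j2)], where
    [I_p(x) = int_0^x t^(p-1) B(t) dt] and [j1 < j2] are the first two positive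
    zeros of [B].  Since [B > 0] on [(0, j1)] and [B < 0] on [(j1, j2)], the
    function [(t/j1)^p B(t)] of [p] is nonincreasing for every [t] in [(0, j2)];
    hence so is [j1^(-p) I_p(j2)], and a zero of [A a] can be located by the sign
    of [I_p(j2)] at three explicit values of [p].

    - [p = 2c], that is [b = -a-1].  Bessel's equation reads
      [(t^(2c-1) B')' = - t^(2c-1) B], so [I_2c(j2) = - j2^(2c-1) B'(j2) < 0].

    - [p = c + 1/2], that is [b = -1/2].  The integrand [u = t^(c-1/2) B] solves
      [u'' + (1 + (1/4 - a^2)/t^2) u = 0].  Sturm's comparison of the two arches
      of [u], reflected onto each other at [j1], shows that the second one is the
      larger when the coefficient decreases ([|a| < 1/2]), and the smaller when
      it increases ([a > 1/2]).

    - [p = 4c/3], that is [b = -(a+1)/3].  Here [I_p(x) >= 0] for all [x] when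
      [c <= 3/2], because [I_p] is a sum of squares in the manner of Gasper: with
      [nu = (2c-1)/4], [z = x^2/4] and [q_n(z) = sum_k (-z/4)^k / ((nu+n+1)_k k!)],
      [p x^(-p) I_p(x) = sum_n w_n C_n z^n q_n(z)^2], where [w_n >= 0] and [C_n]
      is a terminating hypergeometric sum.  Comparing powers of [z], this is the
      inversion of a finite triangular system ([neumann_inversion]) together
      with Vandermonde's formula for the coefficients of [q_n^2].  The value of
      [nu] makes the sum [C_n] Saalschuetzian, which yields a recurrence expressing
      [C_(n+1)] through [C_n] and a nonnegative term; moreover it makes
      [C_1 = 0], from which the recurrence propagates nonnegativity
      ([gasper_coef_bounds]).

    The first two signs give the lower bounds on [beta], the third the upper
    bound.  The limit at [-1] follows by squeezing, and at [a = 1/2] the two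
    bounds coincide.  Finally, the sign for [a > 1/2] forces [alpha_bar <= 1/2];
    then [alpha_bar] is a zero of [A alpha_bar], so [beta alpha_bar = alpha_bar],
    and the upper bound at [alpha_bar] becomes [alpha_bar <= -1/4]. *)

(** * Rising factorials and Vandermonde's identity *)

Fixpoint rising (x : R) (n : nat) : R :=
  match n with O => 1 | S m => rising x m * (x + INR m) end.

Lemma rising_pos x n : 0 < x -> 0 < rising x n.
Proof.
  intros Hx; induction n as [|n IH]; simpl; [lra|].
  apply Rmult_lt_0_compat; [exact IH|]. pose proof (pos_INR n); lra.
Qed.

Lemma rising_add x n m : rising x (n + m) = rising x n * rising (x + INR n) m.
Proof.
  induction m as [|m IH].
  - rewrite Nat.add_0_r; simpl; ring.
  - rewrite Nat.add_succ_r; simpl; rewrite IH, plus_INR; ring.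
Qed.

Lemma rising_S_l x n : rising x (S n) = x * rising (x + 1) n.
Proof.
  change (S n) with (1 + n)%nat; rewrite rising_add; simpl.
  replace (x + 0) with x by ring. ring.
Qed.

Lemma rising_shift x n : x * rising (x + 1) n = rising x n * (x + INR n).
Proof. rewrite <- rising_S_l; reflexivity. Qed.

Lemma rising_neg_0 n k : (n < k)%nat -> rising (- INR n) k = 0.
Proof.
  intros Hk. replace k with (S n + (k - S n))%nat by lia.
  rewrite rising_add; simpl. ring.
Qed.

Lemma rising_duplication x n : rising (2 * x) (2 * n) = 4 ^ n * rising x n * rising (x + 1/2) n.
Proof.
  induction n as [|n IH].
  - simpl; ring.
  - replace (2 * S n)%nat with (S (S (2 * n))) by lia.
    cbn [rising pow]; rewrite IH, S_INR, mult_INR; simpl (INR 2). field.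
Qed.

Lemma INR_fact_S n : INR (fact (S n)) = INR (S n) * INR (fact n).
Proof. change (fact (S n)) with (S n * fact n)%nat; apply mult_INR. Qed.

Fixpoint falling (x : R) (n : nat) : R :=
  match n with O => 1 | S m => falling x m * (x - INR m) end.

(** With [F i = (x)_i/i!] and [G i = (y)_i/i!] (falling factorials), the factor
    [m+1] distributes as [i + (m+1-i)], and [(i+1) F (i+1) = (x - i) F i]; so the
    sum for [m+1] is [(x + y - m)/(m+1)] times the one for [m]. *)
Lemma falling_vandermonde x y m :
  sum_f_R0 (fun i => falling x i / INR (fact i) * (falling y (m - i) / INR (fact (m - i)))) m
  = falling (x + y) m / INR (fact m).
Proof.
  induction m as [|m IH].
  - simpl; field.
  - set (F := fun i => falling x i / INR (fact i)).
    set (G := fun i => falling y i / INR (fact i)).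
    assert (HF : forall i, INR (S i) * F (S i) = (x - INR i) * F i).
    { intros i; unfold F; rewrite INR_fact_S; cbn [falling]; field.
      split; [apply INR_fact_neq_0|apply not_0_INR; lia]. }
    assert (HG : forall i, INR (S i) * G (S i) = (y - INR i) * G i).
    { intros i; unfold G; rewrite INR_fact_S; cbn [falling]; field.
      split; [apply INR_fact_neq_0|apply not_0_INR; lia]. }
    change (sum_f_R0 (fun i => F i * G (m - i)%nat) m = falling (x + y) m / INR (fact m)) in IH.
    change (sum_f_R0 (fun i => F i * G (S m - i)%nat) (S m)
            = falling (x + y) (S m) / INR (fact (S m))).
    assert (Hm : INR (S m) <> 0) by (apply not_0_INR; lia).
    apply (Rmult_eq_reg_l (INR (S m))); [|exact Hm].
    replace (INR (S m) * (falling (x + y) (S m) / INR (fact (S m))))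
      with ((x + y - INR m) * (falling (x + y) m / INR (fact m))).
    2:{ rewrite INR_fact_S; cbn [falling]; field. split; [apply INR_fact_neq_0|exact Hm]. }
    rewrite <- IH, !scal_sum.
    transitivity (sum_f_R0 (fun i => INR i * F i * G (S m - i)%nat) (S m)
                + sum_f_R0 (fun i => F i * (INR (S m - i) * G (S m - i)%nat)) (S m)).
    { rewrite <- plus_sum; apply sum_eq; intros i Hi.
      replace (F i * G (S m - i)%nat * INR (S m)) with (F i * G (S m - i)%nat * (INR i + INR (S m - i))).
      - ring.
      - rewrite <- plus_INR; do 3 f_equal; lia. }
    rewrite (decomp_sum _ (S m)) by lia.
    rewrite (tech5 (fun i => F i * _) m).
    rewrite Nat.sub_diag. simpl (INR 0); simpl (pred (S m)).
    rewrite !Rmult_0_l, !Rmult_0_r, Rplus_0_l, Rplus_0_r, <- plus_sum.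
    apply sum_eq; intros i Hi.
    rewrite HF. replace (S m - i)%nat with (S (m - i))%nat by lia.
    rewrite HG. replace (S m - S i)%nat with (m - i)%nat by lia.
    rewrite minus_INR by exact Hi. ring.
Qed.

Lemma falling_rising x m : falling (x + INR m - 1) m = rising x m.
Proof.
  revert x; induction m as [|m IH]; intros x; [reflexivity|].
  rewrite rising_S_l, <- IH. cbn [falling]. rewrite S_INR.
  replace (x + 1 + INR m - 1) with (x + (INR m + 1) - 1) by ring. ring.
Qed.

(** Since [(mu)_m / (mu)_i] is the falling factorial of [mu + m - 1] of length
    [m - i], this is Vandermonde's identity with [x = y = mu + m - 1]. *)
Lemma sum_inv_rising_mul mu m : 0 < mu ->
  sum_f_R0 (fun i => / (rising mu i * INR (fact i))
                     * / (rising mu (m - i) * INR (fact (m - i)))) m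
  = rising (2 * mu + INR m - 1) m / (INR (fact m) * rising mu m ^ 2).
Proof.
  intros Hmu.
  assert (Hp : forall i, rising mu i <> 0) by (intros i; apply Rgt_not_eq, rising_pos, Hmu).
  rewrite <- (falling_rising (2 * mu + INR m - 1)).
  replace (2 * mu + INR m - 1 + INR m - 1) with ((mu + INR m - 1) + (mu + INR m - 1)) by ring.
  replace (falling (mu + INR m - 1 + (mu + INR m - 1)) m / (INR (fact m) * rising mu m ^ 2))
    with (/ rising mu m ^ 2 * (falling (mu + INR m - 1 + (mu + INR m - 1)) m / INR (fact m)))
    by (field; split; (apply Hp || apply INR_fact_neq_0)).
  rewrite <- falling_vandermonde, scal_sum; apply sum_eq; intros i Hi.
  assert (H : forall j, (j <= m)%nat ->
            falling (mu + INR m - 1) (m - j) * rising mu j = rising mu m).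
  { intros j Hj.
    replace (mu + INR m - 1) with ((mu + INR j) + INR (m - j) - 1)
      by (rewrite minus_INR by exact Hj; ring).
    rewrite falling_rising. rewrite Rmult_comm, <- rising_add. f_equal; lia. }
  pose proof (H i Hi) as H1. pose proof (H (m - i)%nat ltac:(lia)) as H2.
  replace (m - (m - i))%nat with i in H2 by lia.
  apply (Rmult_eq_reg_l (rising mu i * rising mu (m - i))); [|apply Rmult_integral_contrapositive_currified; apply Hp].
  transitivity (/ INR (fact i) * / INR (fact (m - i))).
  - field. repeat split; try apply Hp; apply INR_fact_neq_0.
  - replace (rising mu i * rising mu (m - i) *
     (falling (mu + INR m - 1) i / INR (fact i) *
      (falling (mu + INR m - 1) (m - i) / INR (fact (m - i))) * / rising mu m ^ 2))
     with ((falling (mu + INR m - 1) (m - i) * rising mu i) *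
           (falling (mu + INR m - 1) i * rising mu (m - i))
           * / INR (fact i) * / INR (fact (m - i)) * / rising mu m ^ 2)
     by (field; repeat split; try apply Hp; apply INR_fact_neq_0).
    rewrite H1, H2. field. repeat split; try apply Hp; apply INR_fact_neq_0.
Qed.

(** * Inversion and positivity of the coefficients in the sum of squares *)

Definition neumann_num (nu : R) (n : nat) : R :=
  match n with
  | O => 1
  | S m => 2 * (INR n + nu) * rising (2 * nu + 1) m
  end.

(** Up to the factor [(-1)^(N-n) (nu+1/2)_N / (nu+1)_N], the coefficient of
    [z^N] in [w_n z^n q_n(z)^2].  The numerator is
    [2 (n+nu) (2nu+1)_(n-1)]; its value at [n = 0] is the limit [1], taken separately
    because [nu] may vanish. *)
Definition neumann_coef (nu : R) (n N : nat) : R :=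
  neumann_num nu n / (INR (fact n) * INR (fact (N - n)) * rising (2 * nu + 1) (N + n)).

(** The part of the summand of a Racah polynomial that depends on its degree [n];
    it vanishes for [k > n]. *)
Definition racah (nu : R) (n k : nat) : R :=
  rising (- INR n) k * rising (INR n + 2 * nu) k.

Lemma racah_0 nu n k : (n < k)%nat -> racah nu n k = 0.
Proof. intros H; unfold racah; rewrite rising_neg_0 by exact H; ring. Qed.

(** The alternating sum telescopes because of the identity
    [2 (N-k) (n+nu) = (N-n) (n+k+2nu) + (n-k) (N+n+2nu)]: the second half of the
    [n]-th term cancels the first half of the previous one. *)
Lemma neumann_partial_sum nu k N m : 0 < 2 * nu + 1 -> (m <= N)%nat ->
  (INR N - INR k) * sum_f_R0 (fun n => (-1) ^ n * neumann_coef nu n N * racah nu n k) m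
  = (-1) ^ m * rising (- INR m) k * rising (2 * nu + 1) (m + k) * (INR N - INR m)
    / (INR (fact m) * INR (fact (N - m)) * rising (2 * nu + 1) (N + m)).
Proof.
  intros Hnu. induction m as [|m IH]; intros Hm.
  - simpl sum_f_R0. unfold neumann_coef, racah; cbn [neumann_num pow].
    rewrite Nat.sub_0_r, Nat.add_0_r. simpl (INR 0); simpl (fact 0); simpl (INR 1).
    destruct k as [|k].
    + simpl. field. split; (apply INR_fact_neq_0 || apply Rgt_not_eq, rising_pos, Hnu).
    + rewrite (rising_S_l (-0)). field.
      split; (apply INR_fact_neq_0 || apply Rgt_not_eq, rising_pos, Hnu).
  - cbn [sum_f_R0]. rewrite Rmult_plus_distr_l, IH by lia. clear IH.
    unfold neumann_coef, racah; cbn [neumann_num pow].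
    assert (Hd : exists d, N = (S m + d)%nat) by (exists (N - S m)%nat; lia).
    destruct Hd as [d ->].
    replace (S m + d - m)%nat with (S d) by lia.
    replace (S m + d - S m)%nat with d by lia.
    rewrite !INR_fact_S.
    replace (S m + d + S m)%nat with (S (S m + d + m)) by lia.
    replace (S m + k)%nat with (S (m + k)) by lia.
    cbn [rising].
    replace (INR (S m) + 2 * nu) with (2 * nu + 1 + INR m) by (rewrite S_INR; ring).
    assert (Hp : forall i, rising (2 * nu + 1) i <> 0)
      by (intros i; apply Rgt_not_eq, rising_pos, Hnu).
    rewrite (rising_add (2 * nu + 1) m k).
    pose proof (rising_shift (- INR (S m)) k) as HX.
    replace (- INR (S m) + 1) with (- INR m) in HX by (rewrite S_INR; ring).
    (* [(n-k) (-n)_k = n (-n+1)_k] with [n = m+1] turns the new factor into the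
       one of the previous partial sum. *)
    assert (HY : rising (- INR m) k = rising (- INR (S m)) k * (INR (S m) - INR k) / INR (S m)).
    { apply (Rmult_eq_reg_l (- INR (S m))).
      - rewrite HX. field. apply not_0_INR; lia.
      - apply Ropp_neq_0_compat, not_0_INR; lia. }
    rewrite HY.
    pose proof (pos_INR m); pose proof (pos_INR k); pose proof (pos_INR d).
    assert (Hq : 2 * nu + 1 + INR (S m + d + m) <> 0)
      by (pose proof (pos_INR (S m + d + m)); lra).
    revert Hq. rewrite !plus_INR, !S_INR. intros Hq.
    field. repeat split; try apply INR_fact_neq_0; try apply Hp; lra.
Qed.

(** For [k < N] the closed form of the partial sums vanishes at [m = N]. *)
Lemma neumann_inversion nu k N : 0 < 2 * nu + 1 -> (k <= N)%nat ->
  sum_f_R0 (fun n => (-1) ^ n * neumann_coef nu n N * racah nu n k) N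
  = if Nat.eqb k N then 1 else 0.
Proof.
  intros Hnu Hk.
  assert (Hp : forall i, rising (2 * nu + 1) i <> 0)
    by (intros i; apply Rgt_not_eq, rising_pos, Hnu).
  destruct (Nat.eqb_spec k N) as [->|Hne].
  - destruct N as [|N].
    { simpl; unfold neumann_coef, racah; simpl. field. }
    cbn [sum_f_R0].
    rewrite (sum_eq_R0 _ N), Rplus_0_l.
    2:{ intros n Hn; rewrite racah_0 by lia; ring. }
    unfold neumann_coef, racah; cbn [neumann_num].
    rewrite Nat.sub_diag. replace (INR (fact 0)) with 1 by reflexivity.
    replace (S N + S N)%nat with (S (N + S N)) by lia. cbn [rising].
    change (rising (- INR (S N)) N * (- INR (S N) + INR N)) with (rising (- INR (S N)) (S N)).
    change (rising (INR (S N) + 2 * nu) N * (INR (S N) + 2 * nu + INR N))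
      with (rising (INR (S N) + 2 * nu) (S N)).
    rewrite (rising_add (2 * nu + 1) N (S N)).
    replace (2 * nu + 1 + INR N) with (INR (S N) + 2 * nu) by (rewrite S_INR; ring).
    (* Only the last term is nonzero, and its numerator is a multiple of
       [(-N)_N = (-1)^N N!]. *)
    assert (HF : forall i, (-1) ^ i * rising (- INR i) i = INR (fact i)).
    { induction i as [|i IH]; [simpl; ring|].
      rewrite rising_S_l, INR_fact_S, <- IH.
      replace (- INR (S i) + 1) with (- INR i) by (rewrite S_INR; ring).
      cbn [pow]; ring. }
    rewrite <- HF.
    assert (H1 : (-1) ^ S N * rising (- INR (S N)) (S N) <> 0) by (rewrite HF; apply INR_fact_neq_0).
    assert (H2 : rising (INR (S N) + 2 * nu) (S N) <> 0).
    { apply Rgt_not_eq, rising_pos. rewrite S_INR; pose proof (pos_INR N); lra. }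
    assert (H3 : 2 * nu + 1 + INR (N + S N) = 2 * (INR (S N) + nu))
      by (rewrite plus_INR, !S_INR; ring).
    rewrite H3.
    assert (H4 : INR (S N) + nu <> 0) by (rewrite S_INR; pose proof (pos_INR N); lra).
    assert (H5 : (-1) ^ S N <> 0) by (apply pow_nonzero; lra).
    assert (H6 : rising (- INR (S N)) (S N) <> 0) by (intros E; apply H1; rewrite E; ring).
    set (X := rising (- INR (S N)) (S N)) in *. set (Y := (-1) ^ S N) in *.
    set (W := rising (INR (S N) + 2 * nu) (S N)) in *. clearbody X Y W.
    set (V := rising (2 * nu + 1) N). assert (V <> 0) by apply Hp. clearbody V.
    set (Z := INR (S N) + nu) in *. clearbody Z.
    field. repeat split; auto.
  - pose proof (neumann_partial_sum nu k N N Hnu (le_n N)) as H.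
    rewrite Rminus_diag, Rmult_0_r, Rdiv_0_l in H.
    apply Rmult_integral in H; destruct H as [H|H]; [|exact H].
    exfalso; apply Hne, INR_eq; lra.
Qed.

Definition racah_weight (nu : R) (k : nat) : R :=
  rising (nu + 1) k / (rising (nu + 1/2) k * rising (2 * nu + 1/2) k * INR (fact k)).

(** The terminating series
    [4F3(-n, n+2nu, nu+1, A; nu+1/2, 2nu+1/2, A+1; 1)], which is Saalschuetzian
    for every [A]. *)
Definition gasper_coef (nu A : R) (n : nat) : R :=
  sum_f_R0 (fun k => racah nu n k * racah_weight nu k * (A / (A + INR k))) n.

Lemma gasper_coef_ext nu A n N : (n <= N)%nat ->
  gasper_coef nu A n = sum_f_R0 (fun k => racah nu n k * racah_weight nu k * (A / (A + INR k))) N.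
Proof.
  intros Hn; induction Hn as [|N Hn IH]; [reflexivity|].
  cbn [sum_f_R0]; rewrite <- IH, racah_0 by lia; ring.
Qed.

Lemma sum_f_R0_switch (u : nat -> nat -> R) N M :
  sum_f_R0 (fun i => sum_f_R0 (u i) M) N = sum_f_R0 (fun j => sum_f_R0 (fun i => u i j) N) M.
Proof.
  rewrite <- !sum_n_Reals.
  transitivity (sum_n (fun i => sum_n (u i) M) N).
  { apply sum_n_ext; intros i; rewrite sum_n_Reals; reflexivity. }
  rewrite sum_n_switch. apply sum_n_ext; intros i; rewrite sum_n_Reals; reflexivity.
Qed.

(** Exchanging the two finite sums leaves the inversion formula, which selects
    the last term [k = N]. *)
Lemma gasper_expansion nu A N : 0 < 2 * nu + 1 ->
  sum_f_R0 (fun n => (-1) ^ n * neumann_coef nu n N * gasper_coef nu A n) N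
  = racah_weight nu N * (A / (A + INR N)).
Proof.
  intros Hnu.
  transitivity (sum_f_R0 (fun n => sum_f_R0 (fun k =>
     (-1) ^ n * neumann_coef nu n N * racah nu n k
        * (racah_weight nu k * (A / (A + INR k)))) N) N).
  { apply sum_eq; intros n Hn. rewrite (gasper_coef_ext _ _ _ _ Hn), scal_sum.
    apply sum_eq; intros k _; ring. }
  rewrite sum_f_R0_switch.
  transitivity (sum_f_R0 (fun k => (if Nat.eqb k N then 1 else 0)
     * (racah_weight nu k * (A / (A + INR k)))) N).
  { apply sum_eq; intros k Hk. rewrite <- (neumann_inversion nu k N Hnu Hk).
    rewrite (Rmult_comm (sum_f_R0 _ _)), scal_sum; reflexivity. }
  destruct N as [|N]; [simpl; ring|].
  cbn [sum_f_R0]. rewrite Nat.eqb_refl, sum_eq_R0; [ring|].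
  intros k Hk. destruct (Nat.eqb_spec k (S N)); [lia|ring].
Qed.

(** The Saalschuetzian series
    [3F2(-N, N+2nu-1, nu+1; nu+1/2, 2nu+1/2; 1)]. *)
Definition saalschutz_sum (nu : R) (N : nat) : R :=
  sum_f_R0 (fun k => rising (- INR N) k * rising (INR N + 2 * nu - 1) k * racah_weight nu k) N.

(** The two multipliers are chosen so that, term by term, the poles at [A = -k]
    cancel: both terms are multiples of [(-n-1)_k (n+2nu)_k], and the bracket
    [(A+n+1)(n+2nu+k) - (n+2nu-A)(n+1-k)] equals [(A+k)(2n+2nu+1)]. *)
Lemma gasper_coef_rec nu A n : 0 < A -> 0 < 2 * nu + 1/2 ->
  (A + INR n + 1) * (INR n + 2 * nu) * gasper_coef nu A (S n)
  = (INR n + 1) * (INR n + 2 * nu - A) * gasper_coef nu A n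
    + A * (2 * INR n + 2 * nu + 1) * saalschutz_sum nu (S n).
Proof.
  intros HA Hnu.
  rewrite (gasper_coef_ext nu A n (S n)) by lia.
  unfold gasper_coef, saalschutz_sum.
  rewrite !scal_sum, <- plus_sum. apply sum_eq; intros k Hk.
  unfold racah.
  pose proof (rising_shift (- INR (S n)) k) as HX.
  replace (- INR (S n) + 1) with (- INR n) in HX by (rewrite S_INR; ring).
  pose proof (rising_shift (INR n + 2 * nu) k) as HY.
  replace (INR n + 2 * nu + 1) with (INR (S n) + 2 * nu) in HY by (rewrite S_INR; ring).
  replace (INR (S n) + 2 * nu - 1) with (INR n + 2 * nu) by (rewrite S_INR; ring).
  rewrite S_INR in HX.
  replace (INR (S n)) with (INR n + 1) in * by (rewrite S_INR; reflexivity).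
  pose proof (pos_INR k).
  set (X' := rising (- (INR n + 1)) k) in *. set (X := rising (- INR n) k) in *.
  set (Y' := rising (INR n + 1 + 2 * nu) k) in *. set (Y := rising (INR n + 2 * nu) k) in *.
  transitivity (X' * ((INR n + 2 * nu) * Y') * racah_weight nu k * (A / (A + INR k)) * (A + INR n + 1)).
  { ring. }
  rewrite HY.
  transitivity (- ((- (INR n + 1)) * X) * Y * racah_weight nu k * (A / (A + INR k)) * (INR n + 2 * nu - A)
    + X' * Y * racah_weight nu k * (A * (2 * INR n + 2 * nu + 1))); [|ring].
  rewrite HX. field. lra.
Qed.

(** Wilf-Zeilberger certificate for the first order recurrence of
    [saalschutz_sum]; at [m = N+1] the right-hand side vanishes. *)
Lemma saalschutz_partial nu N m : 0 < 2 * nu + 1/2 ->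
  sum_f_R0 (fun k =>
     ((nu + 1/2 + INR N) * (2 * nu + 1/2 + INR N)
        * (rising (- INR (S N)) k * rising (INR (S N) + 2 * nu - 1) k)
      - (nu - 1/2 + INR N) * (INR N - 1/2)
        * (rising (- INR N) k * rising (INR N + 2 * nu - 1) k)) * racah_weight nu k) m
  = 2 * (INR N + nu) * (rising (- INR N) m * rising (INR N + 2 * nu) m) * rising (nu + 1) (S m)
    / (rising (nu + 1/2) m * rising (2 * nu + 1/2) m * INR (fact m)).
Proof.
  intros Hnu. pose proof (pos_INR N) as HN.
  replace (INR (S N) + 2 * nu - 1) with (INR N + 2 * nu) by (rewrite S_INR; ring).
  induction m as [|m IH].
  - unfold racah_weight; simpl. field.
  - cbn [sum_f_R0]; rewrite IH; clear IH. unfold racah_weight.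
    rewrite !INR_fact_S.
    rewrite (rising_S_l (- INR (S N)) m).
    replace (- INR (S N) + 1) with (- INR N) by (rewrite S_INR; ring).
    rewrite (rising_S_l (INR N + 2 * nu - 1) m).
    replace (INR N + 2 * nu - 1 + 1) with (INR N + 2 * nu) by ring.
    cbn [rising].
    assert (H1 : rising (nu + 1/2) m <> 0) by (apply Rgt_not_eq, rising_pos; lra).
    assert (H2 : rising (2 * nu + 1/2) m <> 0) by (apply Rgt_not_eq, rising_pos; lra).
    pose proof (pos_INR m). rewrite !S_INR.
    field. repeat split; try assumption; try apply INR_fact_neq_0; lra.
Qed.

Lemma saalschutz_rec nu N : 0 < 2 * nu + 1/2 ->
  (nu + 1/2 + INR N) * (2 * nu + 1/2 + INR N) * saalschutz_sum nu (S N)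
  = (nu - 1/2 + INR N) * (INR N - 1/2) * saalschutz_sum nu N.
Proof.
  intros Hnu.
  pose proof (saalschutz_partial nu N (S N) Hnu) as H.
  rewrite (rising_neg_0 N (S N)) in H by lia.
  replace (saalschutz_sum nu N) with
    (sum_f_R0 (fun k => rising (- INR N) k * rising (INR N + 2 * nu - 1) k * racah_weight nu k) (S N)).
  2:{ cbn [sum_f_R0]. rewrite (rising_neg_0 N (S N)) by lia. unfold saalschutz_sum; ring. }
  unfold saalschutz_sum. apply Rminus_diag_uniq.
  rewrite !scal_sum, <- minus_sum.
  etransitivity; [|etransitivity; [exact H|]].
  - apply sum_eq; intros k _; ring.
  - unfold Rdiv; ring.
Qed.

Lemma saalschutz_bounds nu : -1/4 < nu <= 1/2 ->
  forall N, 0 <= saalschutz_sum nu (S N) <= saalschutz_sum nu 1.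
Proof.
  intros Hnu. induction N as [|N IH].
  - split; [|lra].
    pose proof (saalschutz_rec nu 0 ltac:(lra)) as H.
    replace (saalschutz_sum nu 0) with 1 in H.
    2:{ unfold saalschutz_sum, racah_weight; simpl; field. }
    simpl (INR 0) in H.
    apply Rmult_le_reg_l with ((nu + 1/2 + 0) * (2 * nu + 1/2 + 0)); [nra|].
    rewrite H; nra.
  - pose proof (saalschutz_rec nu (S N) ltac:(lra)) as H.
    pose proof (pos_INR N). rewrite S_INR in H.
    set (a := (nu + 1/2 + (INR N + 1)) * (2 * nu + 1/2 + (INR N + 1))) in H.
    set (b := (nu - 1/2 + (INR N + 1)) * (INR N + 1 - 1/2)) in H.
    assert (0 < a) by (unfold a; nra).
    assert (0 <= b <= a) by (unfold a, b; nra).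
    split; [|apply Rle_trans with (saalschutz_sum nu (S N)); [|apply IH]];
      apply Rmult_le_reg_l with a; try assumption; rewrite H; nra.
Qed.

(** This is what singles out [A = (4nu+1)/3], that is, the slope [-1/3] of the
    upper bound on [beta]. *)
Lemma gasper_coef_1 nu : 0 < 2 * nu + 1/2 -> gasper_coef nu ((4 * nu + 1) / 3) 1 = 0.
Proof.
  intros Hnu. unfold gasper_coef, racah, racah_weight; simpl. field. repeat split; lra.
Qed.

(** From [n = 1] on, [n + 2nu - A >= 0], so the recurrence writes the next
    coefficient as a nonnegative combination of the current one and of a
    Saalschuetz sum; the coefficients at [n = 0, 1] are [1] and [0].  The upper
    bound, which ensures absolute convergence, follows from the same recurrence,
    since [(n+1)(n+2nu-A) + A(2n+2nu+1) = (A+n+1)(n+2nu)]. *)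
Lemma gasper_coef_bounds nu : -1/4 < nu <= 1/2 ->
  forall n, 0 <= gasper_coef nu ((4 * nu + 1) / 3) n <= 1 + saalschutz_sum nu 1.
Proof.
  intros Hnu.
  pose proof (saalschutz_bounds nu Hnu 0) as HS.
  set (A := (4 * nu + 1) / 3). assert (HA : 0 < A) by (unfold A; lra).
  destruct n as [|n].
  { unfold gasper_coef, racah, racah_weight; simpl.
    replace (A / (A + 0)) with 1 by (field; lra). lra. }
  induction n as [|n IH].
  { unfold A; rewrite gasper_coef_1 by lra; lra. }
  pose proof (gasper_coef_rec nu A (S n) HA ltac:(lra)) as H.
  pose proof (saalschutz_bounds nu Hnu (S n)) as Hg.
  pose proof (pos_INR n) as Hn. rewrite S_INR in H.
  set (x := INR n + 1) in *. assert (Hx : 1 <= x) by (unfold x; lra).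
  set (g := saalschutz_sum nu (S (S n))) in *.
  set (M := 1 + saalschutz_sum nu 1) in *.
  set (C := gasper_coef nu A (S n)) in *.
  assert (Hp : 0 < (A + x + 1) * (x + 2 * nu)) by (apply Rmult_lt_0_compat; lra).
  assert (H1 : 0 <= x + 2 * nu - A) by (unfold A; lra).
  assert (H2 : 0 <= (x + 1) * (x + 2 * nu - A)) by (apply Rmult_le_pos; lra).
  assert (H3 : 0 <= A * (2 * x + 2 * nu + 1)) by (apply Rmult_le_pos; lra).
  split; apply Rmult_le_reg_l with ((A + x + 1) * (x + 2 * nu)); try exact Hp; rewrite H.
  - rewrite Rmult_0_r. apply Rplus_le_le_0_compat; apply Rmult_le_pos; tauto.
  - apply Rle_trans with ((x + 1) * (x + 2 * nu - A) * M + A * (2 * x + 2 * nu + 1) * M).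
    + apply Rplus_le_compat; (apply Rmult_le_compat_l; [assumption|]); [apply IH | unfold M; lra].
    + apply Req_le; ring.
Qed.

(** * Positivity of the hypergeometric series *)

Lemma is_series_tail (a : nat -> R) (n : nat) (l : R) :
  is_series (fun k => a (S n + k)%nat) (l - sum_f_R0 a n) <-> is_series a l.
Proof.
  split; intros H.
  - apply is_series_decr_n with (n := S n); [lia|].
    simpl pred; rewrite sum_n_Reals. exact H.
  - apply is_series_incr_n; [lia|]. simpl pred; rewrite sum_n_Reals.
    match goal with |- is_series _ ?x => replace x with l; [exact H|] end.
    change (l = l - sum_f_R0 a n + sum_f_R0 a n). ring.
Qed.

(** Rearrangement of a double series with nonnegative row sums: the diagonal
    partial sum up to [L] differs from the sum of the first [L+1] rows by at most
    the tail of the absolutely convergent diagonal series. *)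
Lemma diagonal_series_nonneg (a : nat -> nat -> R) (l : R) :
  (forall n, exists r, 0 <= r /\ is_series (a n) r) ->
  ex_series (fun N => sum_f_R0 (fun n => Rabs (a n (N - n)%nat)) N) ->
  is_series (fun N => sum_f_R0 (fun n => a n (N - n)%nat) N) l ->
  0 <= l.
Proof.
  intros Hrow Habs Hl.
  set (f := fun n N => if (n <=? N)%nat then a n (N - n)%nat else 0).
  set (d := fun N => sum_f_R0 (fun n => a n (N - n)%nat) N) in *.
  set (g := fun N => sum_f_R0 (fun n => Rabs (a n (N - n)%nat)) N) in *.
  assert (Hf : forall n, exists r, 0 <= r /\ is_series (f n) r).
  { intros n. destruct (Hrow n) as [r [Hr Hs]]. exists r; split; [exact Hr|].
    destruct n as [|n].
    - apply is_series_ext with (2 := Hs). intros N; unfold f; simpl. now rewrite Nat.sub_0_r.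
    - apply (is_series_tail (f (S n)) n).
      rewrite sum_eq_R0, Rminus_0_r.
      2:{ intros k Hk; unfold f. destruct (Nat.leb_spec (S n) k); [lia|reflexivity]. }
      apply is_series_ext with (2 := Hs). intros k; unfold f.
      destruct (Nat.leb_spec (S n) (S n + k)); [|lia]. f_equal; lia. }
  assert (HfL : forall L, exists r, 0 <= r /\ is_series (fun N => sum_f_R0 (fun n => f n N) L) r).
  { induction L as [|L [r [Hr IH]]]; [exact (Hf 0%nat)|].
    destruct (Hf (S L)) as [r' [Hr' H']]. exists (r + r'); split; [lra|].
    exact (is_series_plus _ _ _ _ IH H'). }
  assert (Hdf : forall L N, (N <= L)%nat -> d N = sum_f_R0 (fun n => f n N) L).
  { intros L N HNL. induction HNL as [|L HNL IH].
    - apply sum_eq; intros n Hn; unfold f. destruct (Nat.leb_spec n N); [reflexivity|lia].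
    - cbn [sum_f_R0]; rewrite <- IH. unfold f at 1.
      destruct (Nat.leb_spec (S L) N); [lia|ring]. }
  assert (Hfg : forall L N, Rabs (sum_f_R0 (fun n => f n N) L) <= g N).
  { intros L N. apply Rle_trans with (sum_f_R0 (fun n => Rabs (f n N)) L); [apply Rsum_abs|].
    destruct (Nat.le_gt_cases N L) as [HNL|HNL].
    - apply Req_le. clear - HNL. induction HNL as [|L HNL IH].
      + apply sum_eq; intros n Hn; unfold f. destruct (Nat.leb_spec n N); [reflexivity|lia].
      + cbn [sum_f_R0]; rewrite IH. unfold f at 1.
        destruct (Nat.leb_spec (S L) N); [lia|]. rewrite Rabs_R0; ring.
    - unfold g. replace (sum_f_R0 _ N) with
        (sum_f_R0 (fun n => Rabs (a n (N - n)%nat)) (L + (N - L))) by (f_equal; lia).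
      generalize (N - L)%nat; intros k. induction k as [|k IH].
      + rewrite Nat.add_0_r. apply Req_le, sum_eq; intros n Hn; unfold f.
        destruct (Nat.leb_spec n N); [reflexivity|lia].
      + rewrite Nat.add_succ_r; cbn [sum_f_R0].
        eapply Rle_trans; [exact IH|]. rewrite <- Rplus_0_r at 1.
        apply Rplus_le_compat_l, Rabs_pos. }
  pose proof (Series_correct _ Habs) as Hg.
  apply (is_lim_seq_le (fun L => - (Series g - sum_n g L)) (sum_n d) 0 l).
  - intros L. destruct (HfL L) as [r [Hr Hs]].
    assert (H1 : is_series (fun k => sum_f_R0 (fun n => f n (S L + k)%nat) L) (r - sum_n d L)).
    { rewrite sum_n_Reals, (sum_eq d (fun N => sum_f_R0 (fun n => f n N) L) L)
        by (intros; now apply Hdf).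
      now apply (is_series_tail (fun N => sum_f_R0 (fun n => f n N) L)). }
    assert (H2 : is_series (fun k => g (S L + k)%nat) (Series g - sum_n g L)).
    { rewrite sum_n_Reals. now apply is_series_tail. }
    enough (r - sum_n d L <= Series g - sum_n g L) by lra.
    apply (is_lim_seq_le (sum_n (fun k => sum_f_R0 (fun n => f n (S L + k)%nat) L))
             (sum_n (fun k => g (S L + k)%nat)) (r - sum_n d L) (Series g - sum_n g L)).
    + intros m. rewrite !sum_n_Reals. apply sum_Rle; intros k _.
      eapply Rle_trans; [apply Rle_abs|apply Hfg].
    + exact H1.
    + exact H2.
  - apply is_lim_seq_ext with (fun L => sum_n g L - Series g); [intros L; ring|].
    replace 0 with (Series g - Series g) by ring.
    apply is_lim_seq_minus'; [exact Hg|apply is_lim_seq_const].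
  - exact Hl.
Qed.

Definition bessel_coef (c : R) (m : nat) : R := (-1) ^ m / (rising c m * INR (fact m)).

Lemma bessel_coef_neq c m : 0 < c -> bessel_coef c m <> 0.
Proof.
  intros Hc; unfold bessel_coef. apply Rmult_integral_contrapositive_currified.
  - apply pow_nonzero; lra.
  - apply Rinv_neq_0_compat, Rmult_integral_contrapositive_currified;
      [apply Rgt_not_eq, rising_pos, Hc | apply INR_fact_neq_0].
Qed.

Lemma bessel_coef_S c m : 0 < c ->
  bessel_coef c (S m) = - bessel_coef c m / ((c + INR m) * (INR m + 1)).
Proof.
  intros Hc; unfold bessel_coef. rewrite INR_fact_S, S_INR; cbn [rising pow].
  pose proof (rising_pos c m Hc); pose proof (pos_INR m).
  field. repeat split; try apply INR_fact_neq_0; lra.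
Qed.

Lemma bessel_coef_CV c : 0 < c -> CV_radius (bessel_coef c) = p_infty.
Proof.
  intros Hc. apply CV_radius_infinite_DAlembert.
  - intros n; now apply bessel_coef_neq.
  - apply is_lim_seq_le_le with (u := fun _ => 0) (w := fun n => / c * / INR (S n)).
    + intros n. split; [apply Rabs_pos|].
      pose proof (pos_INR n).
      rewrite bessel_coef_S by exact Hc.
      replace (- bessel_coef c n / ((c + INR n) * (INR n + 1)) / bessel_coef c n)
        with (- (/ (c + INR n) * / (INR n + 1)))
        by (field; repeat split; try (now apply bessel_coef_neq); lra).
      rewrite Rabs_Ropp, Rabs_pos_eq.
      * rewrite S_INR. apply Rmult_le_compat_r; [apply Rlt_le, Rinv_0_lt_compat; lra|].
        apply Rinv_le_contravar; lra.
      * apply Rmult_le_pos; apply Rlt_le, Rinv_0_lt_compat; lra.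
    + apply is_lim_seq_const.
    + replace (Finite 0) with (Rbar_mult (/ c) 0) by (simpl; f_equal; ring).
      apply is_lim_seq_scal_l.
      apply (is_lim_seq_incr_1 (fun n => / INR n)).
      replace (Finite 0) with (Rbar_inv p_infty) by reflexivity.
      apply is_lim_seq_inv; [apply is_lim_seq_INR|discriminate].
Qed.

Lemma CV_radius_damped (b r : nat -> R) : CV_radius b = p_infty ->
  (forall m, 0 <= r m <= 1) -> CV_radius (fun m => b m * r m) = p_infty.
Proof.
  intros Hb Hr.
  assert (H : forall x : R, Rbar_le x (CV_radius (fun m => b m * r m))).
  { intros x. apply (proj1 (Lub_Rbar_correct _)).
    apply (@ex_series_le R_AbsRing R_CompleteNormedModule) with (b := fun n => Rabs (b n * x ^ n)).
    - intros n. change (norm ?y) with (Rabs y). rewrite Rabs_Rabsolu, !Rabs_mult.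
      apply Rmult_le_compat_r; [apply Rabs_pos|].
      rewrite <- (Rmult_1_r (Rabs (b n))) at 2.
      apply Rmult_le_compat_l; [apply Rabs_pos|]. rewrite Rabs_pos_eq; apply Hr.
    - apply CV_disk_inside. rewrite Hb; exact I. }
  destruct (CV_radius (fun m => b m * r m)) as [x| |]; [|reflexivity|].
  - specialize (H (x + 1)); simpl in H; lra.
  - destruct (H 0).
Qed.

Lemma bessel_square mu z : 0 < mu ->
  is_series (fun m => (-1) ^ m * (rising (2 * mu + INR m - 1) m / (INR (fact m) * rising mu m ^ 2)) * z ^ m)
    (PSeries (bessel_coef mu) z ^ 2).
Proof.
  intros Hmu.
  assert (Hcv : Rbar_lt (Rabs z) (CV_radius (bessel_coef mu)))
    by (rewrite bessel_coef_CV by exact Hmu; exact I).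
  assert (Hex : is_pseries (bessel_coef mu) z (PSeries (bessel_coef mu) z))
    by (apply PSeries_correct, CV_disk_correct, CV_disk_inside, Hcv).
  pose proof (is_pseries_mult _ _ _ _ _ Hex Hex Hcv Hcv) as H.
  replace (PSeries (bessel_coef mu) z ^ 2) with (PSeries (bessel_coef mu) z * PSeries (bessel_coef mu) z) by ring.
  eapply is_series_ext; [|exact H]. intros m.
  rewrite pow_n_pow. unfold scal; simpl; unfold mult; simpl. unfold PS_mult.
  rewrite (Rmult_comm (z ^ m)). f_equal.
  rewrite <- sum_inv_rising_mul by exact Hmu. rewrite scal_sum. apply sum_eq; intros i Hi.
  unfold bessel_coef, Rdiv.
  replace ((-1) ^ m) with ((-1) ^ i * (-1) ^ (m - i)) by (rewrite <- pow_add; f_equal; lia).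
  ring.
Qed.

Lemma neumann_num_ge0 nu n : -1/4 < nu -> 0 <= neumann_num nu n.
Proof.
  intros Hnu; destruct n as [|n]; [simpl; lra|]. cbn [neumann_num].
  apply Rmult_le_pos; [|apply Rlt_le, rising_pos; lra].
  rewrite S_INR; pose proof (pos_INR n); lra.
Qed.

Lemma rising_ge_half x n : 1/2 <= x -> 1/2 <= rising x n.
Proof.
  intros Hx. destruct n as [|n]; [simpl; lra|].
  induction n as [|n IH]; [simpl; lra|].
  change (rising x (S (S n))) with (rising x (S n) * (x + INR (S n))).
  rewrite S_INR; pose proof (pos_INR n); nra.
Qed.

(** Cancelling [(2nu+1)_(n-1)] leaves [2 (n+nu) <= 3 (n+2nu)] and a rising
    factorial that is at least [1/2]. *)
Lemma neumann_num_le nu n N : -1/4 < nu -> neumann_num nu n <= 6 * rising (2 * nu + 1) (N + n).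
Proof.
  intros Hnu; destruct n as [|n].
  - pose proof (rising_ge_half (2 * nu + 1) (N + 0) ltac:(lra)). simpl neumann_num; lra.
  - cbn [neumann_num].
    replace (N + S n)%nat with (n + S N)%nat by lia. rewrite rising_add, rising_S_l.
    pose proof (pos_INR n).
    pose proof (rising_ge_half (2 * nu + 1 + INR n + 1) N ltac:(lra)).
    pose proof (rising_pos (2 * nu + 1) n ltac:(lra)).
    rewrite S_INR. rewrite Rmult_comm.
    replace (6 * (rising (2 * nu + 1) n * ((2 * nu + 1 + INR n) * rising (2 * nu + 1 + INR n + 1) N)))
      with (rising (2 * nu + 1) n * ((2 * nu + 1 + INR n) * (6 * rising (2 * nu + 1 + INR n + 1) N))) by ring.
    apply Rmult_le_compat_l; [lra|].
    apply Rle_trans with ((2 * nu + 1 + INR n) * 3); [lra|].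
    apply Rmult_le_compat_l; lra.
Qed.

(** The double series has rows [w_n C_n z^n q_n(z)^2 >= 0] and diagonals
    given by [gasper_expansion]; a product of two exponential series dominates
    it. *)
Theorem gasper_positivity c z : 0 < c <= 3/2 -> 0 <= z ->
  0 <= PSeries (fun m => bessel_coef c m * (2 * c / 3 / (2 * c / 3 + INR m))) z.
Proof.
  intros Hc Hz.
  set (nu := (2 * c - 1) / 4).
  assert (Hnu : -1/4 < nu <= 1/2) by (unfold nu; lra).
  assert (HA : 2 * c / 3 = (4 * nu + 1) / 3) by (unfold nu; field).
  assert (Hcnu : c = 2 * nu + 1/2) by (unfold nu; field).
  rewrite HA. set (A := (4 * nu + 1) / 3). assert (HA0 : 0 < A) by (unfold A; lra).
  set (w := fun n => neumann_num nu n / (4 ^ n * rising (nu + 1) n ^ 2 * INR (fact n)) * gasper_coef nu A n).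
  set (s := fun mu m => rising (2 * mu + INR m - 1) m / (INR (fact m) * rising mu m ^ 2)).
  set (a := fun n m => w n * z ^ n * ((-1) ^ m * s (nu + INR n + 1) m * (z / 4) ^ m)).
  assert (Hp1 : forall n, 0 < rising (nu + 1) n) by (intros; apply rising_pos; lra).
  assert (Hp2 : forall n, 0 < rising (nu + 1/2) n) by (intros; apply rising_pos; lra).
  assert (Hp3 : forall n, 0 < rising (2 * nu + 1) n) by (intros; apply rising_pos; lra).
  assert (Hp4 : forall n, 0 < rising (2 * nu + 1/2) n) by (intros; apply rising_pos; lra).
  assert (Hfact : forall n, 0 < INR (fact n)) by (intros; apply INR_fact_lt_0).
  (* The coefficients of the rows, rewritten with the duplication formula
     [(2nu+1)_2N = 4^N (nu+1/2)_N (nu+1)_N]. *)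
  assert (Hdiag : forall N n, (n <= N)%nat -> a n (N - n)%nat
     = (-z) ^ N * (rising (nu + 1/2) N / rising (nu + 1) N)
       * ((-1) ^ n * neumann_coef nu n N * gasper_coef nu A n)).
  { intros N n Hn. unfold a, w, s, neumann_coef.
    assert (Hd : exists d, N = (n + d)%nat) by (exists (N - n)%nat; lia).
    destruct Hd as [d ->]. replace (n + d - n)%nat with d by lia.
    pose proof (rising_duplication (nu + 1/2) (n + d)) as HD.
    replace (2 * (nu + 1/2)) with (2 * nu + 1) in HD by field.
    replace (nu + 1/2 + 1/2) with (nu + 1) in HD by field.
    replace (2 * (n + d))%nat with ((n + d + n) + d)%nat in HD by lia.
    rewrite rising_add in HD.
    replace (2 * nu + 1 + INR (n + d + n)) with (2 * (nu + INR n + 1) + INR d - 1) in HD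
      by (rewrite !plus_INR; ring).
    replace (rising (2 * (nu + INR n + 1) + INR d - 1) d)
      with (4 ^ (n + d) * rising (nu + 1/2) (n + d) * rising (nu + 1) (n + d) / rising (2 * nu + 1) (n + d + n)).
    2:{ rewrite <- HD. field. apply Rgt_not_eq, Hp3. }
    replace (rising (nu + INR n + 1) d) with (rising (nu + 1) (n + d) / rising (nu + 1) n).
    2:{ rewrite rising_add. replace (nu + 1 + INR n) with (nu + INR n + 1) by ring.
        field. apply Rgt_not_eq, Hp1. }
    replace ((z / 4) ^ d) with (z ^ d * / 4 ^ d)
      by (unfold Rdiv; rewrite Rpow_mult_distr, pow_inv; reflexivity).
    replace ((- z) ^ (n + d)) with ((-1) ^ n * (-1) ^ d * (z ^ n * z ^ d))
      by (rewrite <- !pow_add, <- Rpow_mult_distr; f_equal; ring).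
    rewrite (pow_add 4).
    assert (Hsq : (-1) ^ n * (-1) ^ n = 1) by (rewrite <- Rpow_mult_distr; replace (-1 * -1) with 1 by ring; apply pow1).
    replace ((-1) ^ d) with ((-1) ^ d * ((-1) ^ n * (-1) ^ n)) at 1 by (rewrite Hsq; ring).
    pose proof (Hp1 n); pose proof (Hp1 (n + d)%nat); pose proof (Hp3 (n + d + n)%nat).
    pose proof (Hfact n); pose proof (Hfact d).
    field. repeat split; try lra; apply pow_nonzero; lra. }
  apply (diagonal_series_nonneg a).
  - intros n.
    exists (w n * z ^ n * PSeries (bessel_coef (nu + INR n + 1)) (z / 4) ^ 2).
    split.
    + apply Rmult_le_pos; [apply Rmult_le_pos|apply pow2_ge_0].
      * apply Rmult_le_pos; [|apply gasper_coef_bounds, Hnu].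
        apply Rmult_le_pos; [apply neumann_num_ge0; lra|].
        apply Rlt_le, Rinv_0_lt_compat. pose proof (Hp1 n). pose proof (Hfact n).
        apply Rmult_lt_0_compat; [|assumption].
        apply Rmult_lt_0_compat; apply pow_lt; lra.
      * apply pow_le, Hz.
    + assert (Hmu : 0 < nu + INR n + 1) by (pose proof (pos_INR n); lra).
      exact (@is_series_scal_l R_AbsRing R_NormedModule (w n * z ^ n) _ _
               (bessel_square _ (z / 4) Hmu)).
  - set (M := 6 * (1 + saalschutz_sum nu 1)).
    apply (@ex_series_le R_AbsRing R_CompleteNormedModule) with
      (b := fun N => M * sum_f_R0 (fun n => (z ^ n * / INR (fact n)) * (z ^ (N - n) * / INR (fact (N - n)))) N).
    + intros N. change (norm ?x) with (Rabs x).
      rewrite Rabs_pos_eq by (apply cond_pos_sum; intros; apply Rabs_pos).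
      rewrite scal_sum. apply sum_Rle; intros n Hn.
      rewrite Hdiag by exact Hn.
      pose proof (gasper_coef_bounds nu Hnu n) as HC. fold A in HC.
      rewrite !Rabs_mult, <- !RPow_abs, Rabs_Ropp, (Rabs_pos_eq z) by exact Hz.
      rewrite Rabs_m1, pow1, Rmult_1_l.
      rewrite (Rabs_pos_eq (gasper_coef _ _ _)) by apply HC.
      assert (H1 : 0 <= rising (nu + 1/2) N / rising (nu + 1) N <= 1).
      { split; [apply Rlt_le, Rdiv_lt_0_compat; auto|].
        apply Rle_div_l; [apply Hp1|]. rewrite Rmult_1_l.
        clear - Hnu Hp2 Hp1. induction N as [|N IH]; [simpl; lra|]. cbn [rising].
        pose proof (pos_INR N).
        apply Rmult_le_compat; try lra. apply Rlt_le, Hp2. }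
      rewrite (Rabs_pos_eq (_ / _)) by apply H1.
      assert (H2 : 0 <= neumann_coef nu n N <= 6 * (/ INR (fact n) * / INR (fact (N - n)))).
      { unfold neumann_coef. pose proof (neumann_num_ge0 nu n ltac:(lra)).
        pose proof (neumann_num_le nu n N ltac:(lra)).
        pose proof (Hfact n); pose proof (Hfact (N - n)%nat); pose proof (Hp3 (N + n)%nat).
        assert (0 < INR (fact n) * INR (fact (N - n)) * rising (2 * nu + 1) (N + n))
          by (repeat apply Rmult_lt_0_compat; assumption).
        split.
        - apply Rmult_le_pos; [assumption|]. now apply Rlt_le, Rinv_0_lt_compat.
        - apply Rmult_le_reg_r with (INR (fact n) * INR (fact (N - n)) * rising (2 * nu + 1) (N + n)); [assumption|].
          replace (neumann_num nu n / _ * _) with (neumann_num nu n) by (field; repeat split; lra).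
          replace (6 * _ * _) with (6 * rising (2 * nu + 1) (N + n)) by (field; repeat split; lra).
          assumption. }
      rewrite (Rabs_pos_eq (neumann_coef _ _ _)) by apply H2.
      replace (z ^ n * / INR (fact n) * (z ^ (N - n) * / INR (fact (N - n))) * M)
        with (z ^ N * 1 * ((6 * (/ INR (fact n) * / INR (fact (N - n)))) * (1 + saalschutz_sum nu 1))).
      2:{ replace (z ^ N) with (z ^ n * z ^ (N - n)) by (rewrite <- pow_add; f_equal; lia).
          unfold M; ring. }
      assert (0 <= z ^ N) by (apply pow_le, Hz).
      apply Rmult_le_compat.
      * apply Rmult_le_pos; tauto.
      * apply Rmult_le_pos; tauto.
      * apply Rmult_le_compat_l; tauto.
      * apply Rmult_le_compat; tauto.
    + apply (@ex_series_scal_l R_AbsRing R_NormedModule).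
      assert (He : is_series (fun n => z ^ n * / INR (fact n)) (exp z)).
      { eapply is_series_ext; [|exact (is_exp_Reals z)].
        intros n. rewrite pow_n_pow; reflexivity. }
      assert (Hea : ex_series (fun n => Rabs (z ^ n * / INR (fact n)))).
      { eapply ex_series_ext; [|exists (exp z); exact He].
        intros n; simpl. rewrite Rabs_pos_eq; [reflexivity|].
        apply Rmult_le_pos; [apply pow_le, Hz|]. apply Rlt_le, Rinv_0_lt_compat, Hfact. }
      exists (exp z * exp z). exact (is_series_mult _ _ _ _ He He Hea Hea).
  - assert (Hcv : CV_radius (fun m => bessel_coef c m * (A / (A + INR m))) = p_infty).
    { apply CV_radius_damped; [apply bessel_coef_CV; lra|].
      intros m; pose proof (pos_INR m). split.
      - apply Rlt_le, Rdiv_lt_0_compat; lra.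
      - apply Rmult_le_reg_r with (A + INR m); [lra|]. 
        unfold Rdiv; rewrite Rmult_assoc, Rinv_l; lra. }
    assert (Hs : ex_series (fun m => bessel_coef c m * (A / (A + INR m)) * z ^ m)).
    { apply ex_series_Rabs. apply CV_disk_inside. rewrite Hcv; exact I. }
    unfold PSeries. eapply is_series_ext; [|exact (Series_correct _ Hs)].
    intros N; simpl.
    rewrite (sum_eq _ (fun n => ((-1) ^ n * neumann_coef nu n N * gasper_coef nu A n)
               * ((-z) ^ N * (rising (nu + 1/2) N / rising (nu + 1) N)))).
    2:{ intros n Hn; rewrite Hdiag by exact Hn; ring. }
    rewrite <- scal_sum, gasper_expansion by lra.
    unfold racah_weight, bessel_coef. rewrite <- Hcnu.
    replace ((- z) ^ N) with ((-1) ^ N * z ^ N) by (rewrite <- Rpow_mult_distr; f_equal; ring).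
    pose proof (Hp1 N); pose proof (Hp2 N); pose proof (Hp4 N); pose proof (Hfact N).
    pose proof (pos_INR N). rewrite <- Hcnu in *.
    field. repeat split; lra.
Qed.

(** * The Gamma function *)

Lemma exp_mono x y : x <= y -> exp x <= exp y.
Proof. intros [H| ->]; [apply Rlt_le, exp_increasing, H|apply Rle_refl]. Qed.

Lemma is_derive_Rpower p t : 0 < t ->
  is_derive (fun s => Rpower s p) t (p * Rpower t (p - 1)).
Proof. intros Ht. apply is_derive_Reals. now apply derivable_pt_lim_power. Qed.

Lemma Rpower_pos t p : 0 < Rpower t p.
Proof. apply exp_pos. Qed.

Lemma continuous_Rpower p t : 0 < t -> continuous (fun s => Rpower s p) t.
Proof.
  intros Ht. apply (ex_derive_continuous (fun s => Rpower s p)).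
  eexists; now apply is_derive_Rpower.
Qed.

Lemma Rpower_lim_0 p : 0 < p -> filterlim (fun t => Rpower t p) (at_right 0) (locally 0).
Proof.
  intros Hp. apply filterlim_locally; intros eps.
  assert (Hd : 0 < Rpower eps (/ p)) by apply exp_pos.
  exists (mkposreal _ Hd). intros t Ht Ht0.
  change (Rabs (t - 0) < Rpower eps (/ p)) in Ht. change (Rabs (Rpower t p - 0) < eps).
  rewrite Rminus_0_r in *. rewrite Rabs_pos_eq in Ht by lra.
  rewrite Rabs_pos_eq by (apply Rlt_le, exp_pos).
  replace (pos eps) with (Rpower (Rpower eps (/ p)) p).
  - apply Rlt_Rpower_l; lra.
  - rewrite Rpower_mult, Rinv_l by lra. apply Rpower_1, cond_pos.
Qed.

Lemma at_right_lt (x y : R) : x < y -> at_right x (fun t => x < t < y).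
Proof.
  intros H. assert (Hd : 0 < y - x) by lra.
  exists (mkposreal _ Hd). intros t Ht Htx.
  change (Rabs (t - x) < y - x) in Ht. apply Rabs_def2 in Ht. lra.
Qed.

(** The integrals over compact intervals increase with the interval, so they
    converge to their supremum. *)
Lemma is_RInt_gen_bounded (f : R -> R) (M : R) :
  (forall t, 0 < t -> continuous f t) -> (forall t, 0 < t -> 0 <= f t) ->
  (forall a b, 0 < a < b -> RInt f a b <= M) ->
  exists l, is_RInt_gen f (at_right 0) (Rbar_locally p_infty) l /\
    forall a b, 0 < a < b -> RInt f a b <= l.
Proof.
  intros Hc Hp HM.
  assert (Hex : forall a b, 0 < a -> 0 < b -> ex_RInt f a b).
  { intros a b Ha Hb. apply (ex_RInt_continuous (V := R_CompleteNormedModule)).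
    intros t Ht. apply Hc. apply Rlt_le_trans with (2 := proj1 Ht). now apply Rmin_glb_lt. }
  destruct (completeness (fun y => exists a b, 0 < a < b /\ y = RInt f a b)) as [l [Hub Hlub]].
  - exists M. intros y (a & b & Hab & ->). now apply HM.
  - exists (RInt f 1 2), 1, 2; split; [lra|reflexivity].
  - exists l; split.
    2:{ intros a b Hab; apply Hub; exists a, b; auto. }
    intros P [eps HP].
    assert (He : exists a0 b0, 0 < a0 < b0 /\ l - eps < RInt f a0 b0).
    { apply NNPP; intros Hn. pose proof (cond_pos eps).
      enough (l <= l - eps) by lra. apply Hlub.
      intros y (a & b & Hab & ->). apply Rnot_lt_le; intros Hlt. apply Hn; eauto. }
    destruct He as (a0 & b0 & Hab0 & He).
    apply Filter_prod with (Q := fun a => 0 < a < a0) (R := fun b => b0 < b).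
    + apply at_right_lt; lra.
    + exists b0; auto.
    + intros a b Ha Hb; simpl. exists (RInt f a b). split.
      * apply (RInt_correct (V := R_CompleteNormedModule)), Hex; lra.
      * apply HP. change (Rabs (RInt f a b - l) < eps).
        assert (H1 : RInt f a b <= l) by (apply Hub; exists a, b; split; [lra|auto]).
        assert (H2 : RInt f a0 b0 <= RInt f a b).
        { rewrite <- (RInt_Chasles f a a0 b) by (apply Hex; lra).
          rewrite <- (RInt_Chasles f a0 b0 b) by (apply Hex; lra).
          assert (0 <= RInt f a a0) by (apply RInt_ge_0; [lra|apply Hex; lra|intros; apply Hp; lra]).
          assert (0 <= RInt f b0 b) by (apply RInt_ge_0; [lra|apply Hex; lra|intros; apply Hp; lra]).
          unfold plus; simpl. lra. }
        apply Rabs_def1; lra.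
Qed.

Definition gamma_integrand (x t : R) : R := Rpower t (x - 1) * exp (- t).

Lemma gamma_integrand_cont x t : 0 < t -> continuous (gamma_integrand x) t.
Proof.
  intros Ht. apply (continuous_mult (fun t => Rpower t (x - 1)) (fun t => exp (- t))).
  - now apply continuous_Rpower.
  - apply (ex_derive_continuous (fun t => exp (- t))). auto_derive; auto.
Qed.

(** Taking logarithms, this is [ln y <= y] at [y = t / (2x)], multiplied by [x]. *)
Lemma Rpower_exp_le x t : 0 < x -> 0 < t -> 
  Rpower t x * exp (- t) <= exp (x * ln (2 * x)) * exp (- (t / 2)).
Proof.
  intros Hx Ht. unfold Rpower. rewrite <- !exp_plus. apply exp_mono.
  assert (H : ln (t / (2 * x)) <= t / (2 * x)).
  { assert (0 < t / (2 * x)) by (apply Rdiv_lt_0_compat; lra).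
    pose proof (exp_ineq1_le (ln (t / (2 * x)))) as H1.
    rewrite exp_ln in H1 by assumption. lra. }
  rewrite ln_div in H by lra.
  apply (Rmult_le_compat_l x) in H; [|lra].
  replace (x * (t / (2 * x))) with (t / 2) in H by (field; lra). lra.
Qed.

(** The integrand is dominated by the derivative of the bounded function
    [- K / (1 + t^x)], for [K] large. *)
Lemma gamma_integral_bounded x : 0 < x ->
  exists M, forall a b, 0 < a < b -> RInt (gamma_integrand x) a b <= M.
Proof.
  intros Hx.
  (* [K] is chosen so that [exp (-t) (1 + t^x)^2 <= K x], see [Rpower_exp_le]. *)
  set (C := exp (x * ln (2 * x))). assert (HC : 0 < C) by apply exp_pos.
  set (K := (1 + C) ^ 2 / x). assert (HK : 0 < K) by (apply Rdiv_lt_0_compat; [apply pow_lt|]; lra).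
  exists K. intros a b Hab.
  set (Phi := fun t => - K / (1 + Rpower t x)).
  set (phi := fun t => K * (x * Rpower t (x - 1)) / (1 + Rpower t x) ^ 2).
  assert (Hpos : forall t, 0 < 1 + Rpower t x) by (intros; pose proof (Rpower_pos t x); lra).
  assert (HPhi : is_RInt phi a b (Phi b - Phi a)).
  { apply (is_RInt_derive (V := R_CompleteNormedModule)).
    - intros t Ht. rewrite Rmin_left, Rmax_right in Ht by lra.
      assert (H1 : is_derive (fun s => 1 + Rpower s x) t (x * Rpower t (x - 1))).
      { replace (x * Rpower t (x - 1)) with (0 + x * Rpower t (x - 1)) by ring.
        apply (is_derive_plus (fun _ => 1) (fun s => Rpower s x)).
        - apply (is_derive_const 1 t). - apply is_derive_Rpower; lra. }
      pose proof (is_derive_inv _ t _ H1 (Rgt_not_eq _ _ (Hpos t))) as H2.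
      pose proof (is_derive_scal _ t (- K) _ H2) as H3.
      unfold phi, Phi.
      replace (K * (x * Rpower t (x - 1)) / (1 + Rpower t x) ^ 2)
        with (- K * (- (x * Rpower t (x - 1)) / (1 + Rpower t x) ^ 2))
        by (field; apply Rgt_not_eq, Hpos).
      exact H3.
    - intros t Ht. rewrite Rmin_left, Rmax_right in Ht by lra.
      unfold phi. apply (continuous_mult (fun t => K * (x * Rpower t (x - 1))) (fun t => / (1 + Rpower t x) ^ 2)).
      + apply (continuous_scal_r K (fun t => x * Rpower t (x - 1))).
        apply (continuous_scal_r x (fun t => Rpower t (x - 1))). apply continuous_Rpower; lra.
      + apply continuous_comp with (g := fun y => / (1 + y) ^ 2).
        * apply continuous_Rpower; lra.
        * apply (ex_derive_continuous (fun y => / (1 + y) ^ 2)). auto_derive.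
          pose proof (Hpos t); nra. }
  apply Rle_trans with (RInt phi a b).
  - apply RInt_le; [lra| |eexists; exact HPhi|].
    + apply (ex_RInt_continuous (V := R_CompleteNormedModule)). intros t Ht.
      rewrite Rmin_left in Ht by lra. apply gamma_integrand_cont; lra.
    + intros t Ht. unfold gamma_integrand, phi.
      pose proof (Rpower_pos t (x - 1)) as Hp1. pose proof (Rpower_pos t x) as Hp2.
      apply Rle_trans with (Rpower t (x - 1) * ((1 + C) ^ 2 / (1 + Rpower t x) ^ 2)).
      2:{ apply Req_le; unfold K; field. pose proof (Hpos t); lra. }
      apply Rmult_le_compat_l; [lra|].
      apply Rle_div_r; [apply pow_lt, Hpos|].
      assert (Hh : exp (- t) = exp (- (t / 2)) ^ 2)
        by (simpl; rewrite Rmult_1_r, <- exp_plus; f_equal; field).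
      rewrite Hh, <- Rpow_mult_distr. apply pow_incr.
      pose proof (exp_pos (- (t / 2))) as Hep. split; [pose proof (Hpos t); nra|].
      assert (exp (- (t / 2)) <= 1) by (rewrite <- exp_0; apply exp_mono; lra).
      assert (exp (- (t / 2)) * Rpower t x <= C).
      { apply Rmult_le_reg_l with (exp (- (t / 2))); [exact Hep|].
        pose proof (Rpower_exp_le x t Hx ltac:(lra)) as H1. rewrite Hh in H1. fold C in H1. nra. }
      nra.
  - rewrite (is_RInt_unique _ _ _ _ HPhi). unfold Phi.
    assert (0 < K / (1 + Rpower b x)) by (apply Rdiv_lt_0_compat; auto).
    assert (K / (1 + Rpower a x) <= K).
    { apply Rle_div_l; [apply Hpos|]. pose proof (Rpower_pos a x). nra. }
    unfold Rdiv in *. lra.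
Qed.

Lemma is_RInt_gen_Gamma x : 0 < x ->
  is_RInt_gen (gamma_integrand x) (at_right 0) (Rbar_locally p_infty) (Gamma x) /\ 0 < Gamma x.
Proof.
  intros Hx. destruct (gamma_integral_bounded x Hx) as [M HM].
  assert (Hp : forall t, 0 < gamma_integrand x t)
    by (intros; apply Rmult_lt_0_compat; apply exp_pos).
  destruct (is_RInt_gen_bounded (gamma_integrand x) M) as [l [Hl Hle]].
  - apply gamma_integrand_cont.
  - intros t _; apply Rlt_le, Hp.
  - exact HM.
  - assert (HG : Gamma x = l) by (apply is_RInt_gen_unique; exact Hl).
    rewrite HG; split; [exact Hl|].
    apply Rlt_le_trans with (RInt (gamma_integrand x) 1 2); [|apply Hle; lra].
    apply RInt_gt_0; [lra|intros; apply Hp|].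
    intros t Ht; apply gamma_integrand_cont; lra.
Qed.

Lemma Gamma_pos x : 0 < x -> 0 < Gamma x.
Proof. intros Hx; now apply is_RInt_gen_Gamma. Qed.

(** Integration by parts: the function [- t^x exp (-t)] vanishes at both ends of
    [(0, +oo)]. *)
Lemma Gamma_S x : 0 < x -> Gamma (x + 1) = x * Gamma x.
Proof.
  intros Hx.
  destruct (is_RInt_gen_Gamma x Hx) as [H1 _].
  destruct (is_RInt_gen_Gamma (x + 1) ltac:(lra)) as [H2 _].
  set (F := fun t => - (Rpower t x * exp (- t))).
  assert (HF : forall t, 0 < t -> is_derive F t (gamma_integrand (x + 1) t - x * gamma_integrand x t)).
  { intros t Ht. unfold F, gamma_integrand.
    replace (x + 1 - 1) with x by ring.
    replace (Rpower t x * exp (- t) - x * (Rpower t (x - 1) * exp (- t)))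
      with (- (x * Rpower t (x - 1) * exp (- t) + Rpower t x * (- exp (- t)))) by ring.
    apply (is_derive_opp (fun t => Rpower t x * exp (- t))).
    apply (is_derive_mult (fun t => Rpower t x) (fun t => exp (- t))).
    - now apply is_derive_Rpower.
    - auto_derive; [auto|ring].
    - intros; apply Rmult_comm. }
  assert (Hloc : filter_prod (at_right 0) (Rbar_locally p_infty)
            (fun ab => 0 < fst ab /\ 0 < snd ab)).
  { apply Filter_prod with (Q := fun a => 0 < a < 1) (R := fun b => 0 < b).
    - apply at_right_lt; lra.
    - exists 0; auto.
    - simpl; intros; lra. }
  assert (H0 : is_RInt_gen (Derive F) (at_right 0) (Rbar_locally p_infty) (0 - 0)).
  { apply is_RInt_gen_Derive.
    - revert Hloc; apply filter_imp. intros [a b]; simpl; intros [Ha Hb] t Ht.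
      eexists; apply HF. apply Rlt_le_trans with (2 := proj1 Ht). now apply Rmin_glb_lt.
    - revert Hloc; apply filter_imp. intros [a b]; simpl; intros [Ha Hb] t Ht.
      assert (Ht0 : 0 < t) by (apply Rlt_le_trans with (2 := proj1 Ht); now apply Rmin_glb_lt).
      apply continuous_ext_loc with (fun t => gamma_integrand (x + 1) t - x * gamma_integrand x t).
      + exists (mkposreal t Ht0). intros s Hs. symmetry; apply is_derive_unique, HF.
        change (Rabs (s - t) < t) in Hs. apply Rabs_def2 in Hs; lra.
      + apply (continuous_minus (gamma_integrand (x + 1))); [now apply gamma_integrand_cont|].
        apply (continuous_scal_r x (gamma_integrand x)). now apply gamma_integrand_cont.
    - rewrite <- Ropp_0 at 2. apply (filterlim_comp _ _ _ (fun t => Rpower t x * exp (- t)) Ropp _ (locally 0)).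
      + apply filterlim_locally; intros eps.
        pose proof (proj1 (filterlim_locally _ _) (Rpower_lim_0 x Hx) eps) as He.
        pose proof (at_right_lt 0 1 ltac:(lra)) as Hr.
        generalize (filter_and _ _ He Hr). apply filter_imp. intros t [Hb Ht].
        change (Rabs (Rpower t x - 0) < eps) in Hb. change (Rabs (Rpower t x * exp (- t) - 0) < eps).
        rewrite Rminus_0_r in *. rewrite Rabs_mult. 
        assert (exp (- t) <= 1) by (rewrite <- exp_0; apply exp_mono; lra).
        pose proof (exp_pos (- t)). rewrite (Rabs_pos_eq (exp _)) by lra.
        pose proof (Rabs_pos (Rpower t x)). nra.
      + apply (continuous_opp (fun x => x) 0), continuous_id.
    - rewrite <- Ropp_0 at 1. apply (filterlim_comp _ _ _ (fun t => Rpower t x * exp (- t)) Ropp _ (locally 0)).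
      2: apply (continuous_opp (fun x => x) 0), continuous_id.
      apply (is_lim_le_le_loc (fun _ => 0) (fun t => exp (x * ln (2 * x)) * exp (- (t / 2)))
               (fun t => Rpower t x * exp (- t)) p_infty 0).
      + exists 0. intros t Ht. split; [apply Rlt_le, Rmult_lt_0_compat; apply exp_pos|].
        now apply Rpower_exp_le.
      + apply is_lim_const.
      + replace (Finite 0) with (Rbar_mult (exp (x * ln (2 * x))) 0) by (simpl; f_equal; ring).
        apply is_lim_scal_l.
        apply is_lim_comp with (l := m_infty).
        * apply is_lim_exp_m.
        * apply is_lim_ext with (fun t => - / 2 * t); [intros; field|].
          replace m_infty with (Rbar_mult (- / 2) p_infty).
          -- apply is_lim_scal_l, is_lim_id.
          -- simpl. destruct (Rle_dec 0 (- / 2)); [exfalso; lra|reflexivity].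
        * exists 0; intros; discriminate. }
  assert (H3 : is_RInt_gen (Derive F) (at_right 0) (Rbar_locally p_infty) (Gamma (x + 1) - x * Gamma x)).
  { apply is_RInt_gen_ext with (fun t => gamma_integrand (x + 1) t - x * gamma_integrand x t).
    - revert Hloc; apply filter_imp. intros [a b]; simpl; intros [Ha Hb] t Ht.
      symmetry; apply is_derive_unique, HF. apply Rlt_trans with (2 := proj1 Ht). now apply Rmin_glb_lt.
    - apply (is_RInt_gen_minus (V := R_NormedModule) (gamma_integrand (x + 1)) (fun t => x * gamma_integrand x t)); [exact H2|].
      apply (is_RInt_gen_scal (V := R_NormedModule) (gamma_integrand x) x). exact H1. }
  apply Rminus_diag_uniq.
  rewrite <- (is_RInt_gen_unique _ _ H3), (is_RInt_gen_unique _ _ H0). ring.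
Qed.

Lemma Gamma_rising x n : 0 < x -> Gamma (INR n + x) = rising x n * Gamma x.
Proof.
  intros Hx; induction n as [|n IH].
  - simpl; rewrite Rplus_0_l; ring.
  - rewrite S_INR. replace (INR n + 1 + x) with (INR n + x + 1) by ring.
    pose proof (pos_INR n).
    rewrite Gamma_S, IH by lra. cbn [rising]. ring.
Qed.

(** * The normalised Bessel function and its weighted primitives *)

Lemma filterlim_at_right_mult (f g : R -> R) (x lf lg : R) :
  filterlim f (at_right x) (locally lf) -> filterlim g (at_right x) (locally lg) ->
  filterlim (fun t => f t * g t) (at_right x) (locally (lf * lg)).
Proof.
  intros Hf Hg. eapply filterlim_comp_2; [exact Hf|exact Hg|].
  exact (filterlim_mult lf lg).
Qed.

Lemma continuous_at_right (f : R -> R) x : continuous f x -> filterlim f (at_right x) (locally (f x)).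
Proof.
  intros Hf P HP. apply filter_le_within. exact (Hf P HP).
Qed.

(** The even entire function [Gamma(c) (t/2)^(1-c) J_(c-1)(t)]. *)
Definition norm_bessel (c t : R) : R := PSeries (bessel_coef c) (t ^ 2 / 4).
Definition norm_bessel' (c t : R) : R := t / 2 * PSeries (PS_derive (bessel_coef c)) (t ^ 2 / 4).

Lemma CV_infinite_inside a z : CV_radius a = p_infty -> Rbar_lt (Rabs z) (CV_radius a).
Proof. intros ->; exact I. Qed.

Lemma CV_infinite_ex a z : CV_radius a = p_infty -> ex_pseries a z.
Proof. intros H. apply CV_disk_correct, CV_disk_inside, CV_infinite_inside, H. Qed.

(** Bessel's equation in the variable [z = t^2/4]: [z y'' + c y' + y = 0]. *)
Lemma bessel_coef_ode c z : 0 < c ->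
  z * PSeries (PS_derive (PS_derive (bessel_coef c))) z
  + c * PSeries (PS_derive (bessel_coef c)) z + PSeries (bessel_coef c) z = 0.
Proof.
  intros Hc. pose proof (bessel_coef_CV c Hc) as H0.
  assert (H1 : CV_radius (PS_derive (bessel_coef c)) = p_infty) by now rewrite CV_radius_derive.
  assert (H2 : CV_radius (PS_derive (PS_derive (bessel_coef c))) = p_infty) by now rewrite CV_radius_derive.
  rewrite <- PSeries_incr_1, <- PSeries_scal, <- !PSeries_plus.
  - rewrite (PSeries_ext _ (fun _ => 0)); [apply PSeries_const_0|].
    intros n. unfold PS_plus, PS_scal, PS_incr_1, PS_derive, plus, scal; simpl.
    unfold mult; simpl. destruct n as [|n].
    + rewrite (bessel_coef_S c 0) by exact Hc. unfold zero; simpl. field. lra.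
    + rewrite (bessel_coef_S c (S n)) by exact Hc. rewrite !S_INR.
      pose proof (pos_INR n). change (match n with 0%nat => 1 | S _ => INR n + 1 end) with (INR (S n)).
      rewrite ?S_INR. field. lra.
  - apply ex_pseries_plus; [apply ex_pseries_incr_1|apply ex_pseries_scal; [apply Rmult_comm|]];
      now apply CV_infinite_ex.
  - now apply CV_infinite_ex.
  - apply ex_pseries_incr_1; now apply CV_infinite_ex.
  - apply ex_pseries_scal; [apply Rmult_comm|]; now apply CV_infinite_ex.
Qed.

Lemma is_derive_quarter_square t : is_derive (fun s => s ^ 2 / 4) t (t / 2).
Proof. auto_derive; [auto|field]. Qed.

Lemma is_derive_PSeries_quarter a t : CV_radius a = p_infty ->
  is_derive (fun s => PSeries a (s ^ 2 / 4)) t (t / 2 * PSeries (PS_derive a) (t ^ 2 / 4)).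
Proof.
  intros Ha.
  apply (is_derive_comp (PSeries a) (fun s => s ^ 2 / 4)).
  - apply is_derive_PSeries, CV_infinite_inside, Ha.
  - apply is_derive_quarter_square.
Qed.

Lemma is_derive_norm_bessel c t : 0 < c -> is_derive (norm_bessel c) t (norm_bessel' c t).
Proof. intros Hc. apply is_derive_PSeries_quarter, bessel_coef_CV, Hc. Qed.

Lemma is_derive_norm_bessel' c t : 0 < c -> 0 < t ->
  is_derive (norm_bessel' c) t (- norm_bessel c t - (2 * c - 1) / t * norm_bessel' c t).
Proof.
  intros Hc Ht.
  assert (H1 : CV_radius (PS_derive (bessel_coef c)) = p_infty)
    by (rewrite CV_radius_derive; now apply bessel_coef_CV).
  pose proof (bessel_coef_ode c (t ^ 2 / 4) Hc) as Hode.
  unfold norm_bessel, norm_bessel'.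
  set (b0 := PSeries (bessel_coef c) (t ^ 2 / 4)) in *.
  set (b1 := PSeries (PS_derive (bessel_coef c)) (t ^ 2 / 4)) in *.
  set (b2 := PSeries (PS_derive (PS_derive (bessel_coef c))) (t ^ 2 / 4)) in *.
  replace (- b0 - (2 * c - 1) / t * (t / 2 * b1)) with (/ 2 * b1 + t / 2 * (t / 2 * b2)).
  - apply (is_derive_mult (fun t => t / 2) (fun t => PSeries (PS_derive (bessel_coef c)) (t ^ 2 / 4))).
    + auto_derive; [auto|field].
    + now apply is_derive_PSeries_quarter.
    + intros; apply Rmult_comm.
  - replace (t / 2 * (t / 2 * b2)) with (- c * b1 - b0) by lra. field. lra.
Qed.

Lemma norm_bessel_0 c : norm_bessel c 0 = 1.
Proof.
  unfold norm_bessel. replace (0 ^ 2 / 4) with 0 by field. rewrite PSeries_0.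
  unfold bessel_coef; simpl; field.
Qed.

Lemma norm_bessel_cont c t : 0 < c -> continuous (norm_bessel c) t.
Proof. intros Hc. apply (ex_derive_continuous (norm_bessel c)). eexists; now apply is_derive_norm_bessel. Qed.

(** The integral of [s^(p-1) norm_bessel c s] over [(0, t)], integrated term by
    term; [t^p / p] is factored out so that what remains is the hypergeometric
    series of [gasper_positivity]. *)
Definition bessel_primitive (c p t : R) : R :=
  Rpower t p / p * PSeries (fun m => bessel_coef c m * (p / 2 / (p / 2 + INR m))) (t ^ 2 / 4).

Lemma bessel_primitive_CV c p : 0 < c -> 0 < p ->
  CV_radius (fun m => bessel_coef c m * (p / 2 / (p / 2 + INR m))) = p_infty.
Proof.
  intros Hc Hp. apply CV_radius_damped; [now apply bessel_coef_CV|].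
  intros m; pose proof (pos_INR m). split.
  - apply Rlt_le, Rdiv_lt_0_compat; lra.
  - apply Rle_div_l; lra.
Qed.

Lemma is_derive_bessel_primitive c p t : 0 < c -> 0 < p -> 0 < t ->
  is_derive (bessel_primitive c p) t (Rpower t (p - 1) * norm_bessel c t).
Proof.
  intros Hc Hp Ht. unfold bessel_primitive, norm_bessel.
  set (r := fun m => bessel_coef c m * (p / 2 / (p / 2 + INR m))).
  pose proof (bessel_primitive_CV c p Hc Hp) as Hr. fold r in Hr.
  assert (Hr' : CV_radius (PS_derive r) = p_infty) by now rewrite CV_radius_derive.
  set (z := t ^ 2 / 4).
  assert (Hb : PSeries (bessel_coef c) z = PSeries r z + (2 / p) * (z * PSeries (PS_derive r) z)).
  { rewrite <- PSeries_incr_1, <- PSeries_scal, <- PSeries_plus.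
    - apply PSeries_ext. intros n. unfold PS_plus, PS_scal, PS_incr_1, PS_derive, plus, scal; simpl.
      unfold mult; simpl. unfold r. destruct n as [|n].
      + unfold zero; simpl. field. lra.
      + pose proof (pos_INR n).
        change (match n with 0%nat => 1 | S _ => INR n + 1 end) with (INR (S n)).
        rewrite ?S_INR. field. lra.
    - now apply CV_infinite_ex.
    - apply ex_pseries_scal; [apply Rmult_comm|]. apply ex_pseries_incr_1. now apply CV_infinite_ex. }
  rewrite Hb.
  assert (Ht1 : Rpower t p = t * Rpower t (p - 1)).
  { rewrite <- (Rpower_1 t) at 2 by exact Ht. rewrite <- Rpower_plus. f_equal; ring. }
  replace (Rpower t (p - 1) * (PSeries r z + 2 / p * (z * PSeries (PS_derive r) z)))
    with (/ p * (p * Rpower t (p - 1)) * PSeries r z + Rpower t p / p * (t / 2 * PSeries (PS_derive r) z)).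
  2:{ rewrite Ht1. unfold z. field. lra. }
  apply (is_derive_mult (fun t => Rpower t p / p) (fun t => PSeries r (t ^ 2 / 4))).
  - apply is_derive_ext with (fun t => / p * Rpower t p); [intros; apply Rmult_comm|].
    apply (is_derive_scal (fun t => Rpower t p)). now apply is_derive_Rpower.
  - now apply is_derive_PSeries_quarter.
  - intros; apply Rmult_comm.
Qed.

Lemma bessel_primitive_lim_0 c p : 0 < c -> 0 < p ->
  filterlim (bessel_primitive c p) (at_right 0) (locally 0).
Proof.
  intros Hc Hp.
  set (r := fun m => bessel_coef c m * (p / 2 / (p / 2 + INR m))).
  replace 0 with (0 * (/ p * PSeries r (0 ^ 2 / 4))) at 2 by ring.
  apply filterlim_ext with (fun t => Rpower t p * (/ p * PSeries r (t ^ 2 / 4))).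
  { intros t; unfold bessel_primitive; fold r. field. lra. }
  apply filterlim_at_right_mult; [now apply Rpower_lim_0|].
  apply (continuous_at_right (fun t => / p * PSeries r (t ^ 2 / 4))).
  apply (ex_derive_continuous (fun t => / p * PSeries r (t ^ 2 / 4))).
  eexists. apply (is_derive_scal (fun t => PSeries r (t ^ 2 / 4))).
  apply is_derive_PSeries_quarter. now apply bessel_primitive_CV.
Qed.

Lemma bessel_J_eq a t : -1 < a -> 0 < t ->
  bessel_J a t = Rpower (/ 2) a / Gamma (a + 1) * (Rpower t a * norm_bessel (a + 1) t).
Proof.
  intros Ha Ht. unfold bessel_J, norm_bessel, PSeries.
  rewrite <- Rmult_assoc, <- Series_scal_l. apply Series_ext; intros m.
  rewrite Rplus_assoc, Gamma_rising by lra. unfold bessel_coef.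
  rewrite Rpower_plus.
  replace (Rpower (t / 2) (2 * INR m)) with ((t ^ 2 / 4) ^ m).
  - replace (Rpower (t / 2) a) with (Rpower (/ 2) a * Rpower t a).
    + pose proof (Gamma_pos (a + 1) ltac:(lra)). pose proof (rising_pos (a + 1) m ltac:(lra)).
      field. repeat split; try apply INR_fact_neq_0; lra.
    + rewrite Rpower_mult_distr by lra. f_equal. field.
  - replace (2 * INR m) with (INR (2 * m)) by (rewrite mult_INR; reflexivity).
    rewrite Rpower_pow by lra. rewrite pow_mult. f_equal. field.
Qed.

Lemma bessel_J_zero a t : -1 < a -> 0 < t -> (bessel_J a t = 0 <-> norm_bessel (a + 1) t = 0).
Proof.
  intros Ha Ht. rewrite bessel_J_eq by assumption.
  pose proof (Gamma_pos (a + 1) ltac:(lra)).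
  pose proof (Rpower_pos (/ 2) a). pose proof (Rpower_pos t a).
  assert (0 < Rpower (/ 2) a / Gamma (a + 1)) by now apply Rdiv_lt_0_compat.
  split; intros E; [|rewrite E; ring].
  apply Rmult_integral in E; destruct E as [E|E]; [lra|].
  apply Rmult_integral in E; destruct E as [E|E]; [lra|exact E].
Qed.

Lemma is_RInt_gen_primitive (f F : R -> R) x : 0 < x ->
  (forall t, 0 < t -> is_derive F t (f t)) -> (forall t, 0 < t -> continuous f t) ->
  filterlim F (at_right 0) (locally 0) ->
  is_RInt_gen f (at_right 0) (at_point x) (F x).
Proof.
  intros Hx HF Hf H0 P HP.
  assert (H1 : filterlim (fun a => F x - F a) (at_right 0) (locally (F x - 0))).
  { apply (filterlim_comp _ _ _ F (fun y => F x - y) _ (locally 0)); [exact H0|].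
    apply (ex_derive_continuous (fun y => F x - y)). auto_derive; auto. }
  rewrite Rminus_0_r in H1.
  apply Filter_prod with (Q := fun a => 0 < a < x /\ P (F x - F a)) (R := fun b => b = x).
  - apply filter_and; [now apply at_right_lt|]. exact (H1 P HP).
  - reflexivity.
  - intros a b [Ha HPa] ->; simpl. exists (F x - F a); split; [|exact HPa].
    apply (is_RInt_derive (V := R_CompleteNormedModule)); intros t Ht;
      rewrite Rmin_left in Ht by lra; [apply HF|apply Hf]; lra.
Qed.

(** All questions about the sign of [A a b] are thereby transferred to
    [bessel_primitive], whose order [p = a + 1 - b] is positive exactly when the
    integral converges at [0]. *)
Lemma A_eq a b : -1 < a -> b < a + 1 -> 0 < bessel_zero a 2 ->
  A a b = Rpower (/ 2) a / Gamma (a + 1) * bessel_primitive (a + 1) (a + 1 - b) (bessel_zero a 2).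
Proof.
  intros Ha Hb Hz. set (K := Rpower (/ 2) a / Gamma (a + 1)).
  unfold A. apply is_RInt_gen_unique.
  apply (is_RInt_gen_ext (V := R_NormedModule))
    with (fun t => K * (Rpower t (a + 1 - b - 1) * norm_bessel (a + 1) t)).
  - apply Filter_prod with (Q := fun s => 0 < s < bessel_zero a 2) (R := fun s => s = bessel_zero a 2).
    + now apply at_right_lt.
    + reflexivity.
    + intros x y Hx ->; cbn [fst snd]. rewrite Rmin_left by lra. intros t Ht.
      rewrite bessel_J_eq by lra. fold K.
      replace (a + 1 - b - 1) with (- b + a) by ring. rewrite Rpower_plus.
      match goal with |- ?x = ?y => change (@eq R x y) end. ring.
  - apply (is_RInt_gen_primitive _ (fun t => K * bessel_primitive (a + 1) (a + 1 - b) t)); [exact Hz| | |].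
    + intros t Ht. apply (is_derive_scal (bessel_primitive (a + 1) (a + 1 - b))).
      apply is_derive_bessel_primitive; lra.
    + intros t Ht. apply (continuous_scal_r K (fun t => Rpower t (a + 1 - b - 1) * norm_bessel (a + 1) t)).
      apply (continuous_mult (fun t => Rpower t (a + 1 - b - 1))); [now apply continuous_Rpower|].
      apply norm_bessel_cont; lra.
    + replace 0 with (K * 0) at 2 by ring.
      apply (filterlim_comp _ _ _ (bessel_primitive (a + 1) (a + 1 - b)) (fun y => K * y) _ (locally 0)).
      * apply bessel_primitive_lim_0; lra.
      * apply (ex_derive_continuous (fun y => K * y)). auto_derive; auto.
Qed.

Lemma derive_nonneg_le (F f : R -> R) a b : a <= b ->
  (forall t, a <= t <= b -> is_derive F t (f t)) -> (forall t, a < t < b -> 0 <= f t) -> F a <= F b.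
Proof.
  intros Hab HF Hf. destruct (Req_dec a b) as [->|Hne]; [lra|].
  destruct (MVT_cor2 F f a b) as [t [Ht Htab]]; [lra| |].
  - intros t Ht; apply is_derive_Reals, HF, Ht.
  - pose proof (Hf t Htab). nra.
Qed.

Lemma derive_pos_lt (F f : R -> R) a b : a < b ->
  (forall t, a <= t <= b -> is_derive F t (f t)) -> (forall t, a < t < b -> 0 < f t) -> F a < F b.
Proof.
  intros Hab HF Hf.
  destruct (MVT_cor2 F f a b) as [t [Ht Htab]]; [lra| |].
  - intros t Ht; apply is_derive_Reals, HF, Ht.
  - pose proof (Hf t Htab). nra.
Qed.

(** Monotonicity on an interval open at [0], where the primitives are known only
    through their limit. *)
Lemma derive_nonneg_from_0 (F f : R -> R) x : 0 < x ->
  (forall t, 0 < t <= x -> is_derive F t (f t)) -> (forall t, 0 < t < x -> 0 <= f t) ->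
  filterlim F (at_right 0) (locally 0) -> 0 <= F x.
Proof.
  intros Hx HF Hf H0.
  apply (filterlim_le (F := at_right 0) F (fun _ => F x) 0 (F x)).
  - generalize (at_right_lt 0 x Hx). apply filter_imp. intros t Ht.
    apply derive_nonneg_le with f; [lra| |]; intros s Hs; [apply HF|apply Hf]; lra.
  - exact H0.
  - apply filterlim_const.
Qed.

(** * Zeros of Bessel functions *)

Lemma simple_zero_sign (f : R -> R) x l : is_derive f x l -> f x = 0 -> l <> 0 ->
  exists d, 0 < d /\ forall h, 0 < h < d -> 0 < f (x + h) * l /\ f (x - h) * l < 0.
Proof.
  intros Hf Hx Hl. apply is_derive_Reals in Hf.
  destruct (Hf (Rabs l) (Rabs_pos_lt _ Hl)) as [d Hd].
  assert (Hq : forall h, h <> 0 -> Rabs h < d -> 0 < f (x + h) * l / h).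
  { intros h Hh0 Hhd. specialize (Hd h Hh0 Hhd). rewrite Hx, Rminus_0_r in Hd.
    set (y := f (x + h) / h) in Hd.
    replace (f (x + h) * l / h) with (y * l) by (unfold y; field; assumption).
    clearbody y. unfold Rabs in Hd; destruct (Rcase_abs l), (Rcase_abs (y - l)); nra. }
  exists d; split; [apply cond_pos|]. intros h Hh.
  pose proof (Hq h ltac:(lra) ltac:(rewrite Rabs_pos_eq; lra)) as H1.
  pose proof (Hq (- h) ltac:(lra) ltac:(rewrite Rabs_Ropp, Rabs_pos_eq; lra)) as H2.
  split.
  - replace (f (x + h) * l) with (f (x + h) * l / h * h) by (field; lra). nra.
  - replace (x - h) with (x + - h) by ring.
    replace (f (x + - h) * l) with (- (f (x + - h) * l / - h * h)) by (field; lra). nra.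
Qed.

Lemma le_of_le_left (f : R -> R) m x y : y < x -> continuous f x ->
  (forall t, y < t < x -> m <= f t) -> m <= f x.
Proof.
  intros Hyx Hf H. apply Rnot_lt_le; intros Hlt.
  assert (He : 0 < m - f x) by lra.
  destruct (proj1 (filterlim_locally _ _) Hf (mkposreal _ He)) as [d Hd].
  set (t := x - Rmin (d / 2) ((x - y) / 2)).
  pose proof (cond_pos d).
  assert (Ht : 0 < Rmin (d / 2) ((x - y) / 2)) by (apply Rmin_glb_lt; lra).
  pose proof (Rmin_l (d / 2) ((x - y) / 2)). pose proof (Rmin_r (d / 2) ((x - y) / 2)).
  assert (Hb : ball x d t) by (change (Rabs (t - x) < d); apply Rabs_def1; unfold t; lra).
  specialize (Hd t Hb). change (Rabs (f t - f x) < m - f x) in Hd.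
  apply Rabs_def2 in Hd. pose proof (H t ltac:(unfold t; lra)). lra.
Qed.

Lemma norm_bessel_pos_near_0 c : 0 < c -> exists d, 0 < d /\ forall t, 0 <= t < d -> 0 < norm_bessel c t.
Proof.
  intros Hc.
  destruct (proj1 (filterlim_locally _ _) (norm_bessel_cont c 0 Hc) (mkposreal 1 Rlt_0_1)) as [d Hd].
  exists d; split; [apply cond_pos|]. intros t Ht.
  assert (Hb : ball 0 d t) by (change (Rabs (t - 0) < d); rewrite Rminus_0_r, Rabs_pos_eq; lra).
  specialize (Hd t Hb). change (Rabs (norm_bessel c t - norm_bessel c 0) < 1) in Hd.
  rewrite norm_bessel_0 in Hd. apply Rabs_def2 in Hd; lra.
Qed.

(** A double zero would propagate to the left: with [E = B^2 + B'^2] and [K]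
    large, [E exp(K t)] is nondecreasing on an interval ending at the zero, which
    contradicts [B > 0] near [0]. *)
Lemma norm_bessel_simple_zero c x : 0 < c -> 0 < x -> norm_bessel c x = 0 -> norm_bessel' c x <> 0.
Proof.
  intros Hc Hx H0 H1.
  destruct (norm_bessel_pos_near_0 c Hc) as (e & He & Hpos).
  set (d := Rmin e x / 2).
  assert (Hm : 0 < Rmin e x) by now apply Rmin_glb_lt.
  pose proof (Rmin_l e x); pose proof (Rmin_r e x).
  assert (Hd : 0 < norm_bessel c d) by (apply Hpos; unfold d; lra).
  set (K := 2 * Rabs (2 * c - 1) / d).
  set (E := fun t => norm_bessel c t ^ 2 + norm_bessel' c t ^ 2).
  set (e' := fun t => 2 * norm_bessel c t * norm_bessel' c t
     + 2 * norm_bessel' c t * (- norm_bessel c t - (2 * c - 1) / t * norm_bessel' c t)).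
  assert (HEx : E d * exp (K * d) <= E x * exp (K * x)).
  { apply (derive_nonneg_le (fun t => E t * exp (K * t)) (fun t => e' t * exp (K * t) + E t * (K * exp (K * t)))).
    - unfold d; lra.
    - intros t Ht. assert (0 < t) by (unfold d in Ht; lra).
      apply (is_derive_mult E (fun t => exp (K * t))).
      + unfold E, e'.
        apply (is_derive_plus (fun t => norm_bessel c t ^ 2) (fun t => norm_bessel' c t ^ 2)).
        * replace (2 * norm_bessel c t * norm_bessel' c t) with (INR 2 * norm_bessel' c t * norm_bessel c t ^ 1)
            by (simpl; ring).
          apply (is_derive_pow (norm_bessel c) 2). now apply is_derive_norm_bessel.
        * match goal with |- is_derive _ _ (2 * ?x * ?y) =>
            replace (2 * x * y) with (INR 2 * y * x ^ 1) by (simpl; ring) end.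
          apply (is_derive_pow (norm_bessel' c) 2). now apply is_derive_norm_bessel'.
      + auto_derive; [auto|ring].
      + intros; apply Rmult_comm.
    - intros t Ht. assert (0 < d) by (unfold d; lra).
      replace (e' t * exp (K * t) + E t * (K * exp (K * t))) with ((e' t + K * E t) * exp (K * t)) by ring.
      apply Rmult_le_pos; [|apply Rlt_le, exp_pos]. unfold e', E.
      replace (2 * norm_bessel c t * norm_bessel' c t +
        2 * norm_bessel' c t * (- norm_bessel c t - (2 * c - 1) / t * norm_bessel' c t))
        with (- (2 * ((2 * c - 1) / t)) * norm_bessel' c t ^ 2) by ring.
      assert (HK : 2 * ((2 * c - 1) / t) <= K).
      { unfold K. apply Rle_trans with (2 * Rabs (2 * c - 1) / t).
        - unfold Rdiv. rewrite <- Rmult_assoc. apply Rmult_le_compat_r; [apply Rlt_le, Rinv_0_lt_compat; lra|].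
          pose proof (Rle_abs (2 * c - 1)); lra.
        - apply Rmult_le_compat_l; [pose proof (Rabs_pos (2 * c - 1)); lra|]. apply Rinv_le_contravar; lra. }
      assert (0 <= K) by (unfold K; apply Rmult_le_pos;
        [pose proof (Rabs_pos (2 * c - 1)); lra | apply Rlt_le, Rinv_0_lt_compat; lra]).
      pose proof (pow2_ge_0 (norm_bessel c t)). pose proof (pow2_ge_0 (norm_bessel' c t)). nra. }
  unfold E at 2 in HEx. rewrite H0, H1 in HEx.
  assert (0 < E d) by (unfold E; pose proof (pow2_ge_0 (norm_bessel' c d)); nra).
  pose proof (exp_pos (K * d)). nra.
Qed.

(** Removing the first order term of Bessel's equation: this is a constant times
    [sqrt t J_(c-1)(t)]. *)
Definition liouville_bessel (c t : R) : R := Rpower t (c - 1/2) * norm_bessel c t.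
Definition liouville_bessel' (c t : R) : R :=
  (c - 1/2) * Rpower t (c - 1/2 - 1) * norm_bessel c t + Rpower t (c - 1/2) * norm_bessel' c t.
Definition liouville_coef (c t : R) : R := 1 - (c - 1/2) * (c - 3/2) / t ^ 2.

Lemma is_derive_liouville_bessel c t : 0 < c -> 0 < t -> is_derive (liouville_bessel c) t (liouville_bessel' c t).
Proof.
  intros Hc Ht. unfold liouville_bessel, liouville_bessel'.
  apply (is_derive_mult (fun t => Rpower t (c - 1/2)) (norm_bessel c)).
  - now apply is_derive_Rpower.
  - now apply is_derive_norm_bessel.
  - intros; apply Rmult_comm.
Qed.

Lemma is_derive_liouville_bessel' c t : 0 < c -> 0 < t ->
  is_derive (liouville_bessel' c) t (- liouville_coef c t * liouville_bessel c t).
Proof.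
  intros Hc Ht.
  set (k := c - 1/2). 
  assert (Hp : forall p, Rpower t p = t * Rpower t (p - 1)).
  { intros p. rewrite <- (Rpower_1 t) at 2 by exact Ht. rewrite <- Rpower_plus. f_equal; ring. }
  replace (- liouville_coef c t * liouville_bessel c t) with
    ((k * ((k - 1) * Rpower t (k - 1 - 1)) * norm_bessel c t + k * Rpower t (k - 1) * norm_bessel' c t)
     + (k * Rpower t (k - 1) * norm_bessel' c t
        + Rpower t k * (- norm_bessel c t - (2 * c - 1) / t * norm_bessel' c t))).
  - unfold liouville_bessel'. fold k.
    apply (is_derive_plus (fun t => k * Rpower t (k - 1) * norm_bessel c t) (fun t => Rpower t k * norm_bessel' c t)).
    + apply (is_derive_mult (fun t => k * Rpower t (k - 1)) (norm_bessel c)).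
      * apply (is_derive_scal (fun t => Rpower t (k - 1))). now apply is_derive_Rpower.
      * now apply is_derive_norm_bessel.
      * intros; apply Rmult_comm.
    + apply (is_derive_mult (fun t => Rpower t k) (norm_bessel' c)).
      * now apply is_derive_Rpower.
      * now apply is_derive_norm_bessel'.
      * intros; apply Rmult_comm.
  - unfold liouville_coef, liouville_bessel. fold k. rewrite (Hp k), (Hp (k - 1)).
    replace c with (k + 1/2) by (unfold k; ring). field. lra.
Qed.

(** Sturm's comparison with [sin (t/2)], which solves [s'' + s/4 = 0]: if [u] kept
    a constant sign beyond [T], the Wronskian of [u] and [s] would be monotone on
    an arch of [s] far enough to the right, against its signs at the two ends. *)
Lemma norm_bessel_unbounded_zeros c T : 0 < c -> 0 <= T -> exists t, T < t /\ norm_bessel c t = 0.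
Proof.
  intros Hc HT. apply NNPP; intros Hno.
  set (kap := Rabs ((c - 1/2) * (c - 3/2))).
  assert (Hk : 0 <= kap) by apply Rabs_pos.
  (* Beyond [p] the coefficient of the equation of [u] is at least [1/4]. *)
  set (p := T + 1 + 2 * kap).
  assert (Hq : forall t, p <= t -> 1/4 <= liouville_coef c t).
  { intros t Ht. unfold liouville_coef.
    assert (1 + 4 * kap <= t ^ 2) by (unfold p in Ht; nra).
    enough ((c - 1/2) * (c - 3/2) / t ^ 2 <= 3/4) by lra.
    apply Rle_div_l; [nra|]. pose proof (Rle_abs ((c - 1/2) * (c - 3/2))). fold kap in H0. lra. }
  assert (Hp : T < p) by (unfold p; lra).
  pose proof PI_RGT_0 as Hpi.
  assert (Hcont : Ranalysis1.continuity (norm_bessel c)).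
  { intros x. apply continuity_pt_filterlim. now apply norm_bessel_cont. }
  assert (Hsign : exists sg, (sg = 1 \/ sg = -1) /\ forall t, p <= t -> 0 < sg * norm_bessel c t).
  { assert (Hne : forall t, p <= t -> norm_bessel c t <> 0)
      by (intros t Ht E; apply Hno; exists t; split; [lra|exact E]).
    assert (Hivt : forall t, p <= t -> 0 < norm_bessel c p * norm_bessel c t).
    { intros t Ht. apply Rnot_le_lt; intros Hle.
      pose proof (Hne p (Rle_refl _)). pose proof (Hne t Ht).
      destruct (IVT_gen (norm_bessel c) p t 0 Hcont) as [x [Hx E]].
      - unfold Rmin, Rmax. destruct (Rle_dec (norm_bessel c p) (norm_bessel c t)); split; nra.
      - rewrite Rmin_left in Hx by lra. apply (Hne x); [lra|exact E]. }
    destruct (Rlt_dec 0 (norm_bessel c p)) as [Hs|Hs].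
    - exists 1; split; [auto|]. intros t Ht. pose proof (Hivt t Ht). nra.
    - exists (-1); split; [auto|]. intros t Ht. pose proof (Hivt t Ht).
      pose proof (Hne p (Rle_refl _)). nra. }
  destruct Hsign as (sg & Hsg & Hpos).
  set (W := fun t => sg * (liouville_bessel' c t * sin ((t - p) / 2) - liouville_bessel c t * (/ 2 * cos ((t - p) / 2)))).
  set (W' := fun t => sg * ((- liouville_coef c t * liouville_bessel c t * sin ((t - p) / 2)
                     + liouville_bessel' c t * (/ 2 * cos ((t - p) / 2)))
              - (liouville_bessel' c t * (/ 2 * cos ((t - p) / 2))
                     + liouville_bessel c t * (/ 2 * (- / 2 * sin ((t - p) / 2)))))).
  assert (Hus : forall t, p <= t -> 0 < sg * liouville_bessel c t).
  { intros t Ht. unfold liouville_bessel. pose proof (Rpower_pos t (c - 1/2)). pose proof (Hpos t Ht). nra. }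
  assert (HW : W (p + 2 * PI) <= W p).
  { apply Ropp_le_cancel. apply (derive_nonneg_le (fun t => - W t) (fun t => - W' t)); [lra| |].
    - intros t Ht. assert (0 < t) by lra. apply (is_derive_opp W). unfold W, W'.
      apply (is_derive_scal (fun t => liouville_bessel' c t * sin ((t - p) / 2) - liouville_bessel c t * (/ 2 * cos ((t - p) / 2)))).
      apply (is_derive_minus (fun t => liouville_bessel' c t * sin ((t - p) / 2)) (fun t => liouville_bessel c t * (/ 2 * cos ((t - p) / 2)))).
      + apply (is_derive_mult (liouville_bessel' c) (fun t => sin ((t - p) / 2))).
        * now apply is_derive_liouville_bessel'. 
        * auto_derive; [auto|unfold Rdiv, Rminus; ring]. * intros; apply Rmult_comm.
      + apply (is_derive_mult (liouville_bessel c) (fun t => / 2 * cos ((t - p) / 2))).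
        * now apply is_derive_liouville_bessel. 
        * auto_derive; [auto|unfold Rdiv, Rminus; ring]. * intros; apply Rmult_comm.
    - intros t Ht. unfold W'.
      replace (- _) with ((liouville_coef c t - 1/4) * (sg * liouville_bessel c t) * sin ((t - p) / 2)) by field.
      apply Rmult_le_pos; [apply Rmult_le_pos|].
      + pose proof (Hq t ltac:(lra)); lra.
      + apply Rlt_le, Hus; lra.
      + apply sin_ge_0; lra. }
  unfold W in HW.
  replace ((p + 2 * PI - p) / 2) with PI in HW by field.
  replace ((p - p) / 2) with 0 in HW by field.
  rewrite sin_PI, cos_PI, sin_0, cos_0 in HW.
  pose proof (Hus p ltac:(lra)). pose proof (Hus (p + 2 * PI) ltac:(lra)). nra.
Qed.

(** The zeros being simple, and [B(0) = 1], the zeros beyond [x] stay away from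
    [x], and their infimum is attained. *)
Lemma bessel_next_zero c x : 0 < c -> 0 <= x -> (0 < x -> norm_bessel c x = 0) ->
  exists y, x < y /\ norm_bessel c y = 0 /\ (forall t, x < t < y -> norm_bessel c t <> 0) /\
    Glb_Rbar (fun t => x < t /\ norm_bessel c t = 0) = Finite y.
Proof.
  intros Hc Hx Hz.
  set (E := fun t => x < t /\ norm_bessel c t = 0).
  destruct (norm_bessel_unbounded_zeros c x Hc Hx) as (t0 & Ht0 & Ht0z).
  assert (Hiso : exists d, 0 < d /\ forall t, x < t < x + d -> norm_bessel c t <> 0).
  { destruct Hx as [Hx| <-].
    - destruct (simple_zero_sign (norm_bessel c) x (norm_bessel' c x)) as (d & Hd & Hs).
      + now apply is_derive_norm_bessel.
      + now apply Hz.
      + apply norm_bessel_simple_zero; auto.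
      + exists d; split; [exact Hd|]. intros t Ht E0.
        destruct (Hs (t - x) ltac:(lra)) as [H _].
        replace (x + (t - x)) with t in H by ring. rewrite E0 in H. lra.
    - destruct (norm_bessel_pos_near_0 c Hc) as (d & Hd & Hs).
      exists d; split; [exact Hd|]. intros t Ht E0. pose proof (Hs t ltac:(lra)). lra. }
  destruct Hiso as (d & Hd & Hiso).
  destruct (Glb_Rbar_correct E) as [Hlb Hglb].
  assert (H1 : Rbar_le (Glb_Rbar E) t0) by (apply Hlb; split; assumption).
  assert (H2 : Rbar_le (x + d) (Glb_Rbar E)).
  { apply Hglb. intros t [Ht E0]. simpl. apply Rnot_lt_le; intros Hlt. apply (Hiso t); [lra|exact E0]. }
  destruct (Glb_Rbar E) as [y| |] eqn:Ey; simpl in H1, H2; try tauto.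
  exists y. split; [lra|]. split; [|split; [|reflexivity]].
  - apply NNPP; intros Hne.
    assert (He : 0 < Rabs (norm_bessel c y)) by now apply Rabs_pos_lt.
    destruct (proj1 (filterlim_locally _ _) (norm_bessel_cont c y Hc) (mkposreal _ He)) as [e Hball].
    pose proof (cond_pos e).
    enough (Rbar_le (y + e) y) by (simpl in H0; lra).
    apply Hglb. intros t Ht. pose proof (Hlb t Ht) as Hyt. simpl in Hyt |- *.
    apply Rnot_lt_le; intros Hlt.
    assert (Hb : ball y e t) by (change (Rabs (t - y) < e); apply Rabs_def1; lra).
    specialize (Hball t Hb). change (Rabs (norm_bessel c t - norm_bessel c y) < Rabs (norm_bessel c y)) in Hball.
    destruct Ht as [_ Ht]; rewrite Ht in Hball. rewrite Rminus_0_l, Rabs_Ropp in Hball. lra.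
  - intros t Ht E0. assert (Hyt : Rbar_le y t) by (apply Hlb; split; [lra|exact E0]).
    simpl in Hyt; lra.
Qed.

Lemma norm_bessel_same_sign c x y : 0 < c -> (forall t, x < t < y -> norm_bessel c t <> 0) ->
  forall s t, x < s < y -> x < t < y -> 0 < norm_bessel c s * norm_bessel c t.
Proof.
  intros Hc Hne s t Hs Ht. apply Rnot_le_lt; intros Hle.
  pose proof (Hne s Hs). pose proof (Hne t Ht).
  assert (Hcont : Ranalysis1.continuity (norm_bessel c)).
  { intros r. apply continuity_pt_filterlim. now apply norm_bessel_cont. }
  destruct (IVT_gen (norm_bessel c) s t 0 Hcont) as [r [Hr E]].
  - unfold Rmin, Rmax. destruct (Rle_dec (norm_bessel c s) (norm_bessel c t)); split; nra.
  - apply (Hne r); [|exact E]. revert Hr. unfold Rmin, Rmax. destruct (Rle_dec s t); lra.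
Qed.

Lemma bessel_zero_next a k y : -1 < a -> 0 <= bessel_zero a k ->
  Glb_Rbar (fun t => bessel_zero a k < t /\ norm_bessel (a + 1) t = 0) = Finite y ->
  bessel_zero a (S k) = y.
Proof.
  intros Ha Hk Hy. cbn [bessel_zero].
  rewrite (Glb_Rbar_eqset _ (fun t => bessel_zero a k < t /\ norm_bessel (a + 1) t = 0)), Hy; [reflexivity|].
  intros t. split; intros [Ht E]; (split; [exact Ht|]); apply (bessel_J_zero a t); auto; lra.
Qed.

Lemma bessel_zero_spec a : -1 < a -> let c := a + 1 in
  exists j1 j2, bessel_zero a 2 = j2 /\ 0 < j1 < j2 /\
    norm_bessel c j1 = 0 /\ norm_bessel c j2 = 0 /\
    (forall t, 0 < t < j1 -> 0 < norm_bessel c t) /\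
    (forall t, j1 < t < j2 -> norm_bessel c t < 0) /\
    norm_bessel' c j1 < 0 /\ 0 < norm_bessel' c j2.
Proof.
  intros Ha c. assert (Hc : 0 < c) by (unfold c; lra).
  destruct (bessel_next_zero c 0 Hc (Rle_refl 0)) as (j1 & H1 & Z1 & N1 & G1); [lra|].
  assert (E1 : bessel_zero a 1 = j1) by (apply bessel_zero_next; [exact Ha|simpl; lra|exact G1]).
  destruct (bessel_next_zero c j1 Hc ltac:(lra) ltac:(auto)) as (j2 & H2 & Z2 & N2 & G2).
  assert (E2 : bessel_zero a 2 = j2) by (apply bessel_zero_next; rewrite ?E1; [exact Ha|lra|exact G2]).
  assert (P1 : forall t, 0 < t < j1 -> 0 < norm_bessel c t).
  { intros t Ht. destruct (norm_bessel_pos_near_0 c Hc) as (d & Hd & Hs).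
    assert (Hm : 0 < Rmin d j1) by now apply Rmin_glb_lt.
    pose proof (Rmin_l d j1); pose proof (Rmin_r d j1).
    pose proof (Hs (Rmin d j1 / 2) ltac:(lra)).
    pose proof (norm_bessel_same_sign c 0 j1 Hc N1 (Rmin d j1 / 2) t ltac:(lra) Ht). nra. }
  assert (D1 : norm_bessel' c j1 < 0).
  { destruct (simple_zero_sign (norm_bessel c) j1 (norm_bessel' c j1)) as (d & Hd & Hs);
      [now apply is_derive_norm_bessel|exact Z1|now apply norm_bessel_simple_zero|].
    assert (Hm : 0 < Rmin d j1) by now apply Rmin_glb_lt.
    pose proof (Rmin_l d j1); pose proof (Rmin_r d j1).
    destruct (Hs (Rmin d j1 / 2) ltac:(lra)) as [_ Hs'].
    pose proof (P1 (j1 - Rmin d j1 / 2) ltac:(lra)). nra. }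
  assert (P2 : forall t, j1 < t < j2 -> norm_bessel c t < 0).
  { intros t Ht.
    destruct (simple_zero_sign (norm_bessel c) j1 (norm_bessel' c j1)) as (d & Hd & Hs);
      [now apply is_derive_norm_bessel|exact Z1|lra|].
    assert (Hm : 0 < Rmin d (j2 - j1)) by (apply Rmin_glb_lt; lra).
    pose proof (Rmin_l d (j2 - j1)); pose proof (Rmin_r d (j2 - j1)).
    destruct (Hs (Rmin d (j2 - j1) / 2) ltac:(lra)) as [Hs' _].
    pose proof (norm_bessel_same_sign c j1 j2 Hc N2 (j1 + Rmin d (j2 - j1) / 2) t ltac:(lra) Ht). nra. }
  exists j1, j2. repeat split; try assumption.
  destruct (simple_zero_sign (norm_bessel c) j2 (norm_bessel' c j2)) as (d & Hd & Hs);
    [now apply is_derive_norm_bessel|exact Z2|apply norm_bessel_simple_zero; auto; lra|].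
  assert (Hm : 0 < Rmin d (j2 - j1)) by (apply Rmin_glb_lt; lra).
  pose proof (Rmin_l d (j2 - j1)); pose proof (Rmin_r d (j2 - j1)).
  destruct (Hs (Rmin d (j2 - j1) / 2) ltac:(lra)) as [_ Hs'].
  pose proof (P2 (j2 - Rmin d (j2 - j1) / 2) ltac:(lra)). nra.
Qed.

(** * Sturm comparison of two consecutive arches *)

(** The Wronskian [w v' - v w'] is increasing from [0], so [v / w] increases.
    Were [v <= w] at some point, then [v <= rho w] near [0] with [rho < 1], which
    the equal slopes at [0] forbid. *)
Lemma sturm_comparison (w w1 v v1 p r : R -> R) (S m : R) :
  (forall s, 0 <= s < S -> is_derive w s (w1 s) /\ is_derive w1 s (- p s * w s)) ->
  (forall s, 0 <= s < S -> is_derive v s (v1 s) /\ is_derive v1 s (- r s * v s)) ->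
  w 0 = 0 -> v 0 = 0 -> w1 0 = m -> v1 0 = m -> 0 < m ->
  (forall s, 0 < s < S -> 0 < w s) -> (forall s, 0 < s < S -> 0 < v s) ->
  (forall s, 0 < s < S -> r s < p s) ->
  forall s, 0 < s < S -> w s < v s.
Proof.
  intros Hw Hv w0 v0 w10 v10 Hm wpos vpos Hrp s Hs. apply Rnot_le_lt; intros Hle.
  assert (HW : forall t, 0 < t < S -> 0 < w t * v1 t - v t * w1 t).
  { intros t Ht.
    replace 0 with (w 0 * v1 0 - v 0 * w1 0) by (rewrite w0, v0; ring).
    apply (derive_pos_lt (fun t => w t * v1 t - v t * w1 t)
      (fun t => (w1 t * v1 t + w t * (- r t * v t)) - (v1 t * w1 t + v t * (- p t * w t)))); [lra| |].
    - intros x Hx. destruct (Hw x ltac:(lra)), (Hv x ltac:(lra)).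
      apply (is_derive_minus (fun t => w t * v1 t) (fun t => v t * w1 t)).
      + apply (is_derive_mult w v1); auto. intros; apply Rmult_comm.
      + apply (is_derive_mult v w1); auto. intros; apply Rmult_comm.
    - intros x Hx. pose proof (wpos x ltac:(lra)); pose proof (vpos x ltac:(lra)).
      pose proof (Hrp x ltac:(lra)).
      replace (_ - _) with ((p x - r x) * (w x * v x)) by ring.
      apply Rmult_lt_0_compat; [lra|]. now apply Rmult_lt_0_compat. }
  assert (Hratio : forall x y, 0 < x -> x < y -> y < S -> v x / w x < v y / w y).
  { intros x y Hx Hxy Hy.
    apply (derive_pos_lt (fun t => v t / w t) (fun t => (v1 t * w t - v t * w1 t) / w t ^ 2)); [lra| |].
    - intros t Ht. destruct (Hw t ltac:(lra)), (Hv t ltac:(lra)).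
      apply is_derive_div; auto. apply Rgt_not_eq, wpos; lra.
    - intros t Ht. pose proof (wpos t ltac:(lra)). pose proof (HW t ltac:(lra)).
      apply Rdiv_lt_0_compat; [lra|]. now apply pow_lt. }
  (* The midpoint provides a ratio strictly below [1]. *)
  set (rho := v (s / 2) / w (s / 2)).
  assert (Hrho : rho < 1).
  { apply Rlt_le_trans with (v s / w s); [apply Hratio; lra|].
    apply Rle_div_l; [now apply wpos|]. lra. }
  destruct (simple_zero_sign (fun t => v t - rho * w t) 0 (m - rho * m)) as (d & Hd & Hs').
  - destruct (Hw 0 ltac:(lra)) as [Hw0 _], (Hv 0 ltac:(lra)) as [Hv0 _].
    rewrite w10 in Hw0; rewrite v10 in Hv0.
    apply (is_derive_minus v (fun t => rho * w t)); [exact Hv0|].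
    apply (is_derive_scal w 0 rho m Hw0).
  - rewrite w0, v0; ring.
  - nra.
  - assert (Hmin : 0 < Rmin d (s / 2)) by (apply Rmin_glb_lt; lra).
    pose proof (Rmin_l d (s / 2)); pose proof (Rmin_r d (s / 2)).
    set (x := Rmin d (s / 2) / 2). assert (Hx : 0 < x < d /\ x < s / 2) by (unfold x; lra).
    destruct (Hs' x ltac:(lra)) as [H' _]. rewrite Rplus_0_l in H'.
    pose proof (Hratio x (s / 2) ltac:(lra) ltac:(lra) ltac:(lra)) as H''. fold rho in H''.
    pose proof (wpos x ltac:(lra)).
    assert (v x < rho * w x) by now apply Rlt_div_l.
    assert (0 < m - rho * m) by nra. cbv beta in H'. nra.
Qed.

Lemma is_derive_reflect_left (f : R -> R) j l s :
  is_derive f (j - s) l -> is_derive (fun s => f (j - s)) s (- l).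
Proof.
  intros Hf. replace (- l) with (-1 * l) by ring.
  apply (is_derive_comp f (fun s => j - s)); [exact Hf|]. auto_derive; [auto|ring].
Qed.

Lemma is_derive_reflect_right (f : R -> R) j l s :
  is_derive f (j + s) l -> is_derive (fun s => f (j + s)) s l.
Proof.
  intros Hf. replace l with (1 * l) by ring.
  apply (is_derive_comp f (fun s => j + s)); [exact Hf|]. auto_derive; [auto|ring].
Qed.

(** A solution of [u'' + q u = 0] with a positive arch on [(0, j1)] and a negative
    one on [(j1, j2)], and its primitive [H] that vanishes at [0]. *)
Record two_arches (u u1 q H : R -> R) (j1 j2 : R) : Prop := {
  arch_order : 0 < j1 < j2;
  arch_derive : forall t, 0 < t -> is_derive u t (u1 t);
  arch_ode : forall t, 0 < t -> is_derive u1 t (- q t * u t);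
  arch_pos : forall t, 0 < t < j1 -> 0 < u t;
  arch_neg : forall t, j1 < t < j2 -> u t < 0;
  arch_zero1 : u j1 = 0;
  arch_zero2 : u j2 = 0;
  arch_slope : u1 j1 < 0;
  arch_prim : forall t, 0 < t -> is_derive H t (u t);
  arch_prim_0 : filterlim H (at_right 0) (locally 0)
}.

(** The left arch, run backwards from [j1], solves a reflected equation; so does
    the right arch with its sign changed ([arch_right]).  Both start from [0] with
    slope [- u1 j1]. *)
Lemma arch_left u u1 q H j1 j2 s : two_arches u u1 q H j1 j2 -> s < j1 ->
  is_derive (fun s => u (j1 - s)) s (- u1 (j1 - s)) /\
  is_derive (fun s => - u1 (j1 - s)) s (- q (j1 - s) * u (j1 - s)).
Proof.
  intros Arch Hs. split.
  - apply (is_derive_reflect_left u), (arch_derive _ _ _ _ _ _ Arch); lra.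
  - replace (- q (j1 - s) * u (j1 - s)) with (- - (- q (j1 - s) * u (j1 - s))) by ring.
    apply (is_derive_opp (fun s => u1 (j1 - s))).
    apply is_derive_reflect_left, (arch_ode _ _ _ _ _ _ Arch); lra.
Qed.

Lemma arch_right u u1 q H j1 j2 s : two_arches u u1 q H j1 j2 -> 0 <= s ->
  is_derive (fun s => - u (j1 + s)) s (- u1 (j1 + s)) /\
  is_derive (fun s => - u1 (j1 + s)) s (- q (j1 + s) * - u (j1 + s)).
Proof.
  intros Arch Hs. pose proof (arch_order _ _ _ _ _ _ Arch). split.
  - apply (is_derive_opp (fun s => u (j1 + s))).
    apply is_derive_reflect_right, (arch_derive _ _ _ _ _ _ Arch); lra.
  - replace (- q (j1 + s) * - u (j1 + s)) with (- (- q (j1 + s) * u (j1 + s))) by ring.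
    apply (is_derive_opp (fun s => u1 (j1 + s))).
    apply is_derive_reflect_right, (arch_ode _ _ _ _ _ _ Arch); lra.
Qed.

(** [H (j1 - s) - H (j1 + s)] measures by how much the area of the right arch up
    to distance [s] from [j1] exceeds that of the left arch. *)
Lemma is_derive_arch_difference u u1 q H j1 j2 s : two_arches u u1 q H j1 j2 -> 0 <= s < j1 ->
  is_derive (fun s => H (j1 - s) - H (j1 + s)) s (- u (j1 + s) - u (j1 - s)).
Proof.
  intros Arch Hs.
  replace (- u (j1 + s) - u (j1 - s)) with (- u (j1 - s) - u (j1 + s)) by ring.
  apply (is_derive_minus (fun s => H (j1 - s)) (fun s => H (j1 + s))).
  - apply is_derive_reflect_left, (arch_prim _ _ _ _ _ _ Arch); lra.
  - apply is_derive_reflect_right, (arch_prim _ _ _ _ _ _ Arch); lra.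
Qed.

(** The reflected left arch lies below the right one.  Hence the right arch is at
    least as long, and it has the larger area. *)
Lemma arches_decreasing_q u u1 q H j1 j2 : two_arches u u1 q H j1 j2 ->
  (forall s t, 0 < s < t -> q t < q s) -> H j2 < 0.
Proof.
  intros Arch Hq.
  destruct (Arch) as [Hj Hu Hu1 upos uneg uj1 uj2 u1j1 HH H0].
  set (w := fun s => u (j1 - s)). set (w1 := fun s => - u1 (j1 - s)).
  set (v := fun s => - u (j1 + s)). set (v1 := fun s => - u1 (j1 + s)).
  set (D := fun s => H (j1 - s) - H (j1 + s)).
  set (L := Rmin j1 (j2 - j1)).
  assert (u_cont : forall t, 0 < t -> continuous u t)
    by (intros t Ht; apply (ex_derive_continuous u); eexists; now apply Hu).
  assert (H_cont : forall t, 0 < t -> continuous H t)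
    by (intros t Ht; apply (ex_derive_continuous H); eexists; now apply HH).
  assert (HL1 : L <= j1) by apply Rmin_l. assert (HL2 : L <= j2 - j1) by apply Rmin_r.
  assert (Hwv : forall s, 0 < s < L -> w s < v s).
  { apply (sturm_comparison w w1 v v1 (fun s => q (j1 - s)) (fun s => q (j1 + s)) L (- u1 j1)).
    - intros s Hs; apply (arch_left u u1 q H j1 j2 s Arch); lra. - intros s Hs; apply (arch_right u u1 q H j1 j2 s Arch); lra.
    - unfold w; now rewrite Rminus_0_r. - unfold v; rewrite Rplus_0_r; lra.
    - unfold w1; now rewrite Rminus_0_r. - unfold v1; now rewrite Rplus_0_r.
    - lra.
    - intros s Hs; apply upos; lra.
    - intros s Hs; unfold v. pose proof (uneg (j1 + s) ltac:(lra)); lra.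
    - intros s Hs; apply Hq; lra. }
  assert (Hj12 : j1 <= j2 - j1).
  { apply Rnot_lt_le; intros Hlt.
    assert (HL : L = j2 - j1) by (unfold L; apply Rmin_right; lra).
    assert (Hle : u (j1 - (j2 - j1)) <= - u j2).
    { assert (0 <= v (j2 - j1) - w (j2 - j1)).
      { apply (le_of_le_left (fun s => v s - w s) 0 (j2 - j1) 0); [lra| |].
        - apply (continuous_minus v w).
          + apply (continuous_opp (fun s => u (j1 + s))).
            apply (continuous_comp (fun s => j1 + s) u).
            * apply (ex_derive_continuous (fun s => j1 + s)); auto_derive; auto.
            * apply u_cont; lra.
          + apply (continuous_comp (fun s => j1 - s) u).
            * apply (ex_derive_continuous (fun s => j1 - s)); auto_derive; auto.
            * apply u_cont; lra.
        - intros s Hs. pose proof (Hwv s ltac:(lra)); lra. }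
      unfold v, w in *. replace (j1 + (j2 - j1)) with j2 in * by ring. lra. }
    pose proof (upos (j1 - (j2 - j1)) ltac:(lra)). lra. }
  assert (HL : L = j1) by (unfold L; apply Rmin_left; lra).
  assert (HD0 : D 0 = 0) by (unfold D; rewrite Rminus_0_r, Rplus_0_r; ring).
  assert (HD : forall x y, 0 <= x -> x < y -> y < j1 -> D x < D y).
  { intros x y Hx Hxy Hy. apply (derive_pos_lt D (fun s => v s - w s)); [lra| |].
    - intros s Hs; apply (is_derive_arch_difference u u1 q H j1 j2 s Arch); lra.
    - intros s Hs. pose proof (Hwv s ltac:(lra)); lra. }
  pose proof (HD 0 (j1 / 2) ltac:(lra) ltac:(lra) ltac:(lra)) as Hdel. rewrite HD0 in Hdel.
  (* [H (j1 - s)] is controlled only in the limit [s -> j1], hence the strict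
     gain is recorded at [j1 / 2] first. *)
  assert (H2 : H (2 * j1) <= 0 - D (j1 / 2)).
  { apply (filterlim_le (F := at_right 0) (fun t => H (2 * j1 - t)) (fun t => H t - D (j1 / 2)) (H (2 * j1)) (0 - D (j1 / 2))).
    - generalize (at_right_lt 0 (j1 / 2) ltac:(lra)). apply filter_imp. intros t Ht.
      pose proof (HD (j1 / 2) (j1 - t) ltac:(lra) ltac:(lra) ltac:(lra)) as Hd. unfold D at 2 in Hd.
      replace (j1 - (j1 - t)) with t in Hd by ring.
      replace (j1 + (j1 - t)) with (2 * j1 - t) in Hd by ring. lra.
    - replace (H (2 * j1)) with (H (2 * j1 - 0)) by (f_equal; ring).
      apply (continuous_at_right (fun t => H (2 * j1 - t))).
      apply (continuous_comp (fun t => 2 * j1 - t) H).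
      + apply (ex_derive_continuous (fun t => 2 * j1 - t)); auto_derive; auto.
      + apply H_cont; lra.
    - apply (filterlim_comp _ _ _ H (fun y => y - D (j1 / 2)) _ (locally 0)); [exact H0|].
      apply (ex_derive_continuous (fun y => y - D (j1 / 2))). auto_derive; auto. }
  assert (H3 : - H (2 * j1) <= - H j2).
  { apply (derive_nonneg_le (fun t => - H t) (fun t => - u t)); [lra| |].
    - intros t Ht. apply (is_derive_opp H), HH; lra.
    - intros t Ht. pose proof (uneg t ltac:(lra)); lra. }
  lra.
Qed.

(** Now the right arch lies below the reflected left one.  As [u] tends to [0] at
    [0], the right arch cannot be the longer, so its area is the smaller. *)
Lemma arches_increasing_q u u1 q H j1 j2 : two_arches u u1 q H j1 j2 ->
  (forall s t, 0 < s < t -> q s < q t) ->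
  filterlim u (at_right 0) (locally 0) -> 0 < H j2.
Proof.
  intros Arch Hq Hu0.
  destruct (Arch) as [Hj Hu Hu1 upos uneg uj1 uj2 u1j1 HH H0].
  set (w := fun s => u (j1 - s)). set (w1 := fun s => - u1 (j1 - s)).
  set (v := fun s => - u (j1 + s)). set (v1 := fun s => - u1 (j1 + s)).
  set (D := fun s => H (j1 - s) - H (j1 + s)).
  set (L := Rmin j1 (j2 - j1)).
  assert (u_cont : forall t, 0 < t -> continuous u t)
    by (intros t Ht; apply (ex_derive_continuous u); eexists; now apply Hu).
  assert (H_cont : forall t, 0 < t -> continuous H t)
    by (intros t Ht; apply (ex_derive_continuous H); eexists; now apply HH).
  assert (HL1 : L <= j1) by apply Rmin_l. assert (HL2 : L <= j2 - j1) by apply Rmin_r.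
  assert (Hwv : forall s, 0 < s < L -> v s < w s).
  { apply (sturm_comparison v v1 w w1 (fun s => q (j1 + s)) (fun s => q (j1 - s)) L (- u1 j1)).
    - intros s Hs; apply (arch_right u u1 q H j1 j2 s Arch); lra. - intros s Hs; apply (arch_left u u1 q H j1 j2 s Arch); lra.
    - unfold v; rewrite Rplus_0_r; lra. - unfold w; now rewrite Rminus_0_r.
    - unfold v1; now rewrite Rplus_0_r. - unfold w1; now rewrite Rminus_0_r.
    - lra.
    - intros s Hs; unfold v. pose proof (uneg (j1 + s) ltac:(lra)); lra.
    - intros s Hs; apply upos; lra.
    - intros s Hs; apply Hq; lra. }
  assert (Hj12 : j2 - j1 <= j1).
  { apply Rnot_lt_le; intros Hlt.
    assert (HL : L = j1) by (unfold L; apply Rmin_left; lra).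
    assert (Hle : - u (2 * j1) <= 0).
    { apply (filterlim_le (F := at_right 0) (fun t => - u (2 * j1 - t)) u (- u (2 * j1)) 0).
      - generalize (at_right_lt 0 j1 ltac:(lra)). apply filter_imp. intros t Ht.
        pose proof (Hwv (j1 - t) ltac:(lra)) as Hd. unfold v, w in Hd.
        replace (j1 - (j1 - t)) with t in Hd by ring.
        replace (j1 + (j1 - t)) with (2 * j1 - t) in Hd by ring. lra.
      - replace (- u (2 * j1)) with (- u (2 * j1 - 0)) by (do 2 f_equal; ring).
        apply (continuous_at_right (fun t => - u (2 * j1 - t))).
        apply (continuous_opp (fun t => u (2 * j1 - t))).
        apply (continuous_comp (fun t => 2 * j1 - t) u).
        + apply (ex_derive_continuous (fun t => 2 * j1 - t)); auto_derive; auto.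
        + apply u_cont; lra.
      - exact Hu0. }
    pose proof (uneg (2 * j1) ltac:(lra)). lra. }
  assert (HL : L = j2 - j1) by (unfold L; apply Rmin_right; lra).
  assert (HD0 : D 0 = 0) by (unfold D; rewrite Rminus_0_r, Rplus_0_r; ring).
  assert (HD : forall x y, 0 <= x -> x < y -> y < j2 - j1 -> D y < D x).
  { intros x y Hx Hxy Hy. apply Ropp_lt_cancel.
    apply (derive_pos_lt (fun s => - D s) (fun s => - (v s - w s))); [lra| |].
    - intros s Hs; apply (is_derive_opp D), (is_derive_arch_difference u u1 q H j1 j2 s Arch); lra.
    - intros s Hs. pose proof (Hwv s ltac:(lra)); lra. }
  pose proof (HD 0 ((j2 - j1) / 2) ltac:(lra) ltac:(lra) ltac:(lra)) as Hdel. rewrite HD0 in Hdel.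
  assert (Hpos : forall t, 0 < t <= j1 -> 0 <= H t).
  { intros t Ht. apply (derive_nonneg_from_0 H u); [lra| | |exact H0].
    - intros x Hx; apply HH; lra.
    - intros x Hx; apply Rlt_le, upos; lra. }
  assert (- D ((j2 - j1) / 2) <= H j2).
  { apply (le_of_le_left H _ j2 (j1 + (j2 - j1) / 2)); [lra|apply H_cont; lra|].
    intros t Ht. pose proof (HD ((j2 - j1) / 2) (t - j1) ltac:(lra) ltac:(lra) ltac:(lra)) as Hd.
    unfold D at 1 in Hd. replace (j1 + (t - j1)) with t in Hd by ring.
    pose proof (Hpos (j1 - (t - j1)) ltac:(lra)). lra. }
  lra.
Qed.

(** * Signs of the primitives at the second zero *)

(** The difference of the integrands is [((t/j1)^p - (t/j1)^p') B(t) / t], and the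
    two factors that depend on [t] change sign together at [j1]. *)
Lemma bessel_primitive_mono c p p' j1 j2 : 0 < c -> 0 < p <= p' -> 0 < j1 < j2 ->
  (forall t, 0 < t < j1 -> 0 < norm_bessel c t) -> (forall t, j1 < t < j2 -> norm_bessel c t < 0) ->
  norm_bessel c j1 = 0 ->
  Rpower j1 (- p') * bessel_primitive c p' j2 <= Rpower j1 (- p) * bessel_primitive c p j2.
Proof.
  intros Hc Hp Hj Hpos Hneg Hz.
  apply Rminus_le_0.
  apply (derive_nonneg_from_0
    (fun t => Rpower j1 (- p) * bessel_primitive c p t - Rpower j1 (- p') * bessel_primitive c p' t)
    (fun t => Rpower j1 (- p) * (Rpower t (p - 1) * norm_bessel c t)
              - Rpower j1 (- p') * (Rpower t (p' - 1) * norm_bessel c t))); [lra| | |].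
  - intros t Ht.
    apply (is_derive_minus (fun t => Rpower j1 (- p) * bessel_primitive c p t)
             (fun t => Rpower j1 (- p') * bessel_primitive c p' t)).
    + apply (is_derive_scal (bessel_primitive c p)). apply is_derive_bessel_primitive; lra.
    + apply (is_derive_scal (bessel_primitive c p')). apply is_derive_bessel_primitive; lra.
  - intros t Ht.
    assert (Hfac : forall r, Rpower j1 (- r) * Rpower t (r - 1) = / t * exp (r * (ln t - ln j1))).
    { intros r. unfold Rpower. rewrite <- exp_plus.
      rewrite <- (exp_ln t) at 2 by lra. rewrite <- exp_Ropp, <- exp_plus. f_equal; ring. }
    replace (_ - _) with
      ((/ t * (exp (p * (ln t - ln j1)) - exp (p' * (ln t - ln j1)))) * norm_bessel c t).
    2:{ rewrite Rmult_minus_distr_l, <- !Hfac. ring. }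
    assert (Ht0 : 0 < / t) by (apply Rinv_0_lt_compat; lra).
    destruct (Rtotal_order t j1) as [Hlt|[->|Hgt]].
    + apply Rmult_le_pos; [|apply Rlt_le, Hpos; lra].
      assert (ln t < ln j1) by (apply ln_increasing; lra).
      assert (exp (p' * (ln t - ln j1)) <= exp (p * (ln t - ln j1))) by (apply exp_mono; nra).
      apply Rmult_le_pos; lra.
    + rewrite Hz; lra.
    + assert (Hb : norm_bessel c t < 0) by (apply Hneg; lra).
      assert (ln j1 < ln t) by (apply ln_increasing; lra).
      assert (exp (p * (ln t - ln j1)) <= exp (p' * (ln t - ln j1))) by (apply exp_mono; nra).
      assert (0 <= / t * (exp (p' * (ln t - ln j1)) - exp (p * (ln t - ln j1))))
        by (apply Rmult_le_pos; lra).
      nra.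
  - replace 0 with (Rpower j1 (- p) * 0 - Rpower j1 (- p') * 0) at 2 by ring.
    apply (filterlim_comp_2 (G := locally (Rpower j1 (- p) * 0)) (H := locally (- (Rpower j1 (- p') * 0)))
       (fun t => Rpower j1 (- p) * bessel_primitive c p t) (fun t => - (Rpower j1 (- p') * bessel_primitive c p' t)) Rplus).
    + apply filterlim_at_right_mult; [apply filterlim_const|]. apply bessel_primitive_lim_0; lra.
    + replace (- (Rpower j1 (- p') * 0)) with (- Rpower j1 (- p') * 0) by ring.
      apply filterlim_ext with (fun t => - Rpower j1 (- p') * bessel_primitive c p' t); [intros; ring|].
      apply filterlim_at_right_mult; [apply filterlim_const|]. apply bessel_primitive_lim_0; lra.
    + exact (filterlim_plus (Rpower j1 (- p) * 0) (- (Rpower j1 (- p') * 0))).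
Qed.

(** [- t^(2c-1) B'(t)] is another primitive of [t^(2c-1) B(t)] that vanishes at
    [0]. *)
Lemma bessel_primitive_2c_neg c x : 0 < c -> 0 < x -> 0 < norm_bessel' c x -> bessel_primitive c (2 * c) x < 0.
Proof.
  intros Hc Hx HB.
  set (V := fun t => Rpower t (2 * c - 1) * norm_bessel' c t).
  enough (H : 0 <= - (bessel_primitive c (2 * c) x + V x)).
  { assert (0 < V x) by (apply Rmult_lt_0_compat; [apply Rpower_pos|exact HB]). lra. }
  apply (derive_nonneg_from_0 (fun t => - (bessel_primitive c (2 * c) t + V t)) (fun _ => 0)); [exact Hx| |intros; lra|].
  - intros t Ht. rewrite <- Ropp_0.
    apply (is_derive_opp (fun t => bessel_primitive c (2 * c) t + V t)).
    replace 0 with (Rpower t (2 * c - 1) * norm_bessel c t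
      + ((2 * c - 1) * Rpower t (2 * c - 1 - 1) * norm_bessel' c t
         + Rpower t (2 * c - 1) * (- norm_bessel c t - (2 * c - 1) / t * norm_bessel' c t))).
    + apply (is_derive_plus (bessel_primitive c (2 * c)) V).
      * apply is_derive_bessel_primitive; lra.
      * apply (is_derive_mult (fun t => Rpower t (2 * c - 1)) (norm_bessel' c)).
        -- apply is_derive_Rpower; lra.
        -- apply is_derive_norm_bessel'; lra.
        -- intros; apply Rmult_comm.
    + replace (Rpower t (2 * c - 1)) with (t * Rpower t (2 * c - 1 - 1)).
      * field; lra.
      * rewrite <- (Rpower_1 t) at 1 by lra. rewrite <- Rpower_plus. f_equal; ring.
  - apply filterlim_ext_loc with (fun t => -1 * bessel_primitive c (2 * c) t
       + -1 * (Rpower t (2 * c) * (/ 2 * PSeries (PS_derive (bessel_coef c)) (t ^ 2 / 4)))).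
    + generalize (at_right_lt 0 1 ltac:(lra)). apply filter_imp. intros t Ht.
      unfold V, norm_bessel'.
      replace (Rpower t (2 * c)) with (t * Rpower t (2 * c - 1)); [field|].
      rewrite <- (Rpower_1 t) at 1 by lra. rewrite <- Rpower_plus. f_equal; ring.
    + replace 0 with (-1 * 0 + -1 * (0 * (/ 2 * PSeries (PS_derive (bessel_coef c)) (0 ^ 2 / 4)))) at 2 by ring.
      eapply filterlim_comp_2; [| |apply (filterlim_plus (V := R_NormedModule))].
      * apply filterlim_at_right_mult; [apply filterlim_const|]. apply bessel_primitive_lim_0; lra.
      * apply filterlim_at_right_mult; [apply filterlim_const|].
        apply filterlim_at_right_mult; [apply Rpower_lim_0; lra|].
        apply (continuous_at_right (fun t => / 2 * PSeries (PS_derive (bessel_coef c)) (t ^ 2 / 4))).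
        apply (ex_derive_continuous (fun t => / 2 * PSeries (PS_derive (bessel_coef c)) (t ^ 2 / 4))).
        eexists. apply (is_derive_scal (fun t => PSeries (PS_derive (bessel_coef c)) (t ^ 2 / 4))).
        apply is_derive_PSeries_quarter. rewrite CV_radius_derive. now apply bessel_coef_CV.
Qed.

Lemma bessel_arches c j1 j2 : 0 < c -> 0 < j1 < j2 ->
  norm_bessel c j1 = 0 -> norm_bessel c j2 = 0 ->
  (forall t, 0 < t < j1 -> 0 < norm_bessel c t) -> (forall t, j1 < t < j2 -> norm_bessel c t < 0) ->
  norm_bessel' c j1 < 0 ->
  two_arches (liouville_bessel c) (liouville_bessel' c) (liouville_coef c) (bessel_primitive c (c + 1/2)) j1 j2.
Proof.
  intros Hc Hj Z1 Z2 P1 P2 D1. split.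
  - exact Hj.
  - intros t Ht; now apply is_derive_liouville_bessel.
  - intros t Ht; now apply is_derive_liouville_bessel'.
  - intros t Ht. apply Rmult_lt_0_compat; [apply Rpower_pos|now apply P1].
  - intros t Ht. unfold liouville_bessel. pose proof (Rpower_pos t (c - 1/2)). pose proof (P2 t Ht). nra.
  - unfold liouville_bessel; rewrite Z1; ring.
  - unfold liouville_bessel; rewrite Z2; ring.
  - unfold liouville_bessel'; rewrite Z1. pose proof (Rpower_pos j1 (c - 1/2)). nra.
  - intros t Ht. unfold liouville_bessel. replace (c - 1/2) with (c + 1/2 - 1) by field.
    apply is_derive_bessel_primitive; lra.
  - apply bessel_primitive_lim_0; lra.
Qed.

Lemma inv_square_lt s t : 0 < s < t -> / t ^ 2 < / s ^ 2.
Proof.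
  intros H. apply Rinv_lt_contravar; [|simpl; nra].
  apply Rmult_lt_0_compat; apply pow_lt; lra.
Qed.

Lemma bessel_primitive_half_neg c j1 j2 : 1/2 < c < 3/2 ->
  two_arches (liouville_bessel c) (liouville_bessel' c) (liouville_coef c) (bessel_primitive c (c + 1/2)) j1 j2 ->
  bessel_primitive c (c + 1/2) j2 < 0.
Proof.
  intros Hc Harch. apply (arches_decreasing_q _ _ _ _ _ _ Harch).
  intros s t Hst. unfold liouville_coef.
  pose proof (inv_square_lt s t Hst). assert ((c - 1/2) * (c - 3/2) < 0) by nra.
  unfold Rdiv at 3 6. nra.
Qed.

Lemma bessel_primitive_half_pos c j1 j2 : 3/2 < c ->
  two_arches (liouville_bessel c) (liouville_bessel' c) (liouville_coef c) (bessel_primitive c (c + 1/2)) j1 j2 ->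
  0 < bessel_primitive c (c + 1/2) j2.
Proof.
  intros Hc Harch. apply (arches_increasing_q _ _ _ _ _ _ Harch).
  - intros s t Hst. unfold liouville_coef.
    pose proof (inv_square_lt s t Hst). assert (0 < (c - 1/2) * (c - 3/2)) by nra.
    unfold Rdiv at 3 6. nra.
  - replace 0 with (0 * norm_bessel c 0) at 2 by ring.
    apply filterlim_at_right_mult; [apply Rpower_lim_0; lra|].
    apply continuous_at_right, norm_bessel_cont; lra.
Qed.

Lemma bessel_primitive_gasper c x : 0 < c <= 3/2 -> 0 <= bessel_primitive c (4 * c / 3) x.
Proof.
  intros Hc. unfold bessel_primitive. apply Rmult_le_pos.
  - apply Rlt_le, Rdiv_lt_0_compat; [apply Rpower_pos|lra].
  - replace (4 * c / 3 / 2) with (2 * c / 3) by field.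
    apply gasper_positivity; [exact Hc|]. pose proof (pow2_ge_0 x); lra.
Qed.

(** * Location of the zeros of [A] *)

Lemma A_zero_iff a b : -1 < a -> b < a + 1 ->
  (A a b = 0 <-> bessel_primitive (a + 1) (a + 1 - b) (bessel_zero a 2) = 0).
Proof.
  intros Ha Hb.
  destruct (bessel_zero_spec a Ha) as (j1 & j2 & E2 & Hj & _).
  rewrite A_eq by lra.
  assert (0 < Rpower (/ 2) a / Gamma (a + 1))
    by (apply Rdiv_lt_0_compat; [apply Rpower_pos|apply Gamma_pos; lra]).
  split; intros E; [|rewrite E; ring].
  apply Rmult_integral in E; destruct E as [E|E]; [lra|exact E].
Qed.

Lemma A_zero_lower a b : -1 < a -> b < a + 1 -> A a b = 0 ->
  - a - 1 < b /\ (-1/2 < a < 1/2 -> -1/2 < b).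
Proof.
  intros Ha Hb HA. apply A_zero_iff in HA; try assumption.
  destruct (bessel_zero_spec a Ha) as (j1 & j2 & E2 & Hj & Z1 & Z2 & P1 & P2 & D1 & D2).
  rewrite E2 in HA.
  assert (Hlow : forall b0, b0 < a + 1 -> bessel_primitive (a + 1) (a + 1 - b0) j2 < 0 -> b0 < b).
  { intros b0 Hb0 Hneg. apply Rnot_le_lt; intros Hle.
    pose proof (bessel_primitive_mono (a + 1) (a + 1 - b0) (a + 1 - b) j1 j2
                  ltac:(lra) ltac:(lra) Hj P1 P2 Z1) as Hm.
    rewrite HA in Hm. pose proof (Rpower_pos j1 (- (a + 1 - b0))). nra. }
  split.
  - apply Hlow; [lra|]. replace (a + 1 - (- a - 1)) with (2 * (a + 1)) by ring.
    apply bessel_primitive_2c_neg; lra.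
  - intros Ha'. apply Hlow; [lra|]. replace (a + 1 - -1/2) with (a + 1 + 1/2) by field.
    apply (bessel_primitive_half_neg (a + 1) j1 j2); [lra|]. apply bessel_arches; auto; lra.
Qed.

(** Since the primitive at [p = 4c/3] is nonnegative, a zero [b] of [A a] beyond
    [-(a+1)/3] would, by monotonicity, make [-(a+1)/3] a zero as well; this is
    where the uniqueness of the zero enters. *)
Lemma is_beta_upper a b : -1 < a <= 1/2 -> is_beta a b -> b <= - (1/3) * (a + 1).
Proof.
  intros Ha [[Hb HA] Huniq]. apply A_zero_iff in HA; try lra.
  destruct (bessel_zero_spec a ltac:(lra)) as (j1 & j2 & E2 & Hj & Z1 & Z2 & P1 & P2 & D1 & D2).
  rewrite E2 in HA.
  set (b0 := - (1/3) * (a + 1)). apply Rnot_lt_le; intros Hlt.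
  assert (Hp0 : a + 1 - b0 = 4 * (a + 1) / 3) by (unfold b0; field).
  pose proof (bessel_primitive_mono (a + 1) (a + 1 - b) (a + 1 - b0) j1 j2
                ltac:(lra) ltac:(lra) Hj P1 P2 Z1) as Hm.
  pose proof (bessel_primitive_gasper (a + 1) j2 ltac:(lra)) as Hg.
  rewrite HA in Hm. pose proof (Rpower_pos j1 (- (a + 1 - b0))).
  rewrite <- Hp0 in Hg.
  assert (HA0 : A a b0 = 0) by (apply A_zero_iff; rewrite ?E2; unfold b0 in *; nra).
  enough (b = b0) by lra. apply Huniq; split; [unfold b0; lra|exact HA0].
Qed.

Lemma G_zero_le_half a : -1 < a -> G a = 0 -> a <= 1/2.
Proof.
  intros Ha HG. apply Rnot_lt_le; intros Hlt.
  unfold G in HG. apply A_zero_iff in HG; try lra.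
  destruct (bessel_zero_spec a Ha) as (j1 & j2 & E2 & Hj & Z1 & Z2 & P1 & P2 & D1 & D2).
  rewrite E2 in HG.
  pose proof (bessel_primitive_mono (a + 1) (a + 1 - a) (a + 1 + 1/2) j1 j2
                ltac:(lra) ltac:(lra) Hj P1 P2 Z1) as Hm.
  rewrite HG in Hm.
  assert (0 < bessel_primitive (a + 1) (a + 1 + 1/2) j2).
  { apply (bessel_primitive_half_pos (a + 1) j1 j2); [lra|]. apply bessel_arches; auto; lra. }
  pose proof (Rpower_pos j1 (- (a + 1 + 1/2))). nra.
Qed.

Theorem corollary5p1
  (beta : R -> R) (alpha_bar : R)
  (Hbeta : forall a : R, -1 < a <= 1/2 -> is_beta a (beta a))
  (Halpha_bar : is_alpha_bar alpha_bar) :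
  (* (i); the lower bound is an equality at a = 1/2 *)
  (forall a : R, -1 < a <= 1/2 ->
     Rmax (- a - 1) (-1/2) <= beta a <= - (1/3) * (a + 1) /\
     (a < 1/2 -> Rmax (- a - 1) (-1/2) < beta a)) /\
  (* (ii) *)
  (filterlim beta (at_right (-1)) (locally 0) /\ beta (1/2) = -1/2) /\
  (* (iii) *)
  (-1/2 < alpha_bar <= -1/4).
Proof.
  assert (Hlow : forall a, -1 < a <= 1/2 -> - a - 1 < beta a).
  { intros a Ha. destruct (Hbeta a Ha) as [[Hb HA] _]. apply A_zero_lower; lra. }
  assert (Hup : forall a, -1 < a <= 1/2 -> beta a <= - (1/3) * (a + 1))
    by (intros a Ha; apply is_beta_upper; auto).
  split; [|split; [split|]].
  - intros a Ha. destruct (Hbeta a Ha) as [[Hb HA] _]. pose proof (Hlow a Ha).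
    split; [split; [apply Rmax_lub; lra|now apply Hup]|]. intros Ha'.
    apply Rmax_lub_lt; [lra|].
    destruct (Rle_lt_dec a (-1/2)) as [Hle|Hlt]; [lra|].
    apply (A_zero_lower a); lra.
  - apply filterlim_locally; intros eps.
    assert (Hm : -1 < Rmin (1/2) (-1 + eps)) by (apply Rmin_glb_lt; pose proof (cond_pos eps); lra).
    pose proof (Rmin_l (1/2) (-1 + eps)); pose proof (Rmin_r (1/2) (-1 + eps)).
    generalize (at_right_lt _ _ Hm). apply filter_imp. intros a Ha.
    pose proof (Hlow a ltac:(lra)). pose proof (Hup a ltac:(lra)).
    change (Rabs (beta a - 0) < eps). apply Rabs_def1; lra.
  - destruct (Hbeta (1/2) ltac:(lra)) as [[Hb _] _]. pose proof (Hup (1/2) ltac:(lra)). lra.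
  - destruct Halpha_bar as [[Ha HG] _]. split; [exact Ha|].
    pose proof (G_zero_le_half alpha_bar ltac:(lra) HG) as Hhalf.
    assert (Hb : beta alpha_bar = alpha_bar)
      by (apply (Hbeta alpha_bar ltac:(lra)); split; [lra|exact HG]).
    pose proof (Hup alpha_bar ltac:(lra)). lra.
Qed.
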